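(* Let the gas mass $M>0$ be given (all physical constants being fixed). If the liquid volume $V>0$ is sufficiently small, then there exists a constant $\Theta_0\in(0,1)$ such that $$-\pi^2\chi<\sup\{\operatorname{Re}(\lambda):\lambda\in\operatorname{sp}(\mathcal L)\setminus\{0\}\}\le-\Theta_0\pi^2\chi,$$ where $\chi=\kappa/(R_\dagger^2\rho_\dagger\gamma\mathfrak{c})$ satisfies $$-\pi^2\chi=-\frac{4\kappa\pi^3R_\dagger}{3M\gamma\mathfrak{c}}\in\frac{\kappa\pi^2}{\gamma\mathfrak{c}}\sqrt{\frac{2\pi\mathfrak{R}}{3\sigma}}\left(-\sqrt{\frac{T_c}{M}},\ -\sqrt{\frac{T_c}{M}}\Big/\sqrt{1+\frac{\bar\sigma}{\sigma}}\right).$$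
   Context: Constants: $\rho_l,\mu_l,\kappa,\mathfrak{c},\mathfrak{R},T_c,\sigma,\bar\sigma>0$, $\gamma=1+\mathfrak{R}/\mathfrak{c}$. $\overline V=3V/(4\pi)$. $(\rho_\dagger,R_\dagger)=(\rho_\dagger[M,V],R_\dagger[M,V])$ is the unique pair of positive numbers with $\frac{4\pi}{3}\rho_\dagger R_\dagger^3=M$, $\rho_\dagger=\frac2{\mathfrak{R}T_c}(\frac\sigma{R_\dagger}+\frac{\bar\sigma}{\overline R_\dagger})$, where $\overline R_\dagger=(R_\dagger^3+\overline V)^{1/3}$. Set $\tilde R_\dagger=R_\dagger-R_\dagger^2/\overline R_\dagger$, $A=\frac{2\sigma}{R_\dagger^2}+\frac{2\bar\sigma R_\dagger^2}{\overline R_\dagger^4}$, $B=\frac{4\mu_l\overline V}{R_\dagger(R_\dagger^3+\overline V)}$, $\zeta_j=(j\pi)^2$, $\xi_k=\frac{(-1)^{k-1}2^{3/2}(\gamma-1)}{\sqrt\pi\,\gamma k}$, $\omega_j=-\frac{R_\dagger\chi}{\rho_\dagger}\sqrt{\frac\pi2}(-1)^jj$. $\mathcal L$ is the linear operator on $\ell^2$ given, for $\mathbf z=[\varrho_2,\mathcal R,\dot{\mathcal R},\theta_1,\theta_2,\dots]^\top$ (with $\dot{\mathcal R}$ naming the third coordinate), by $(\mathcal L\mathbf z)_1=\frac{3\gamma\rho_\dagger}{R_\dagger}\big(\sum_j\omega_j\theta_j-\dot{\mathcal R}\big)$, $(\mathcal L\mathbf z)_2=\dot{\mathcal R}$, $(\mathcal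 L\mathbf z)_3=\frac1{\rho_l\tilde R_\dagger}(\mathfrak{R}T_c\varrho_2+A\mathcal R-B\dot{\mathcal R})$, $(\mathcal L\mathbf z)_{3+k}=-\chi\zeta_k\theta_k-\xi_k\frac{3\gamma\rho_\dagger}{R_\dagger}\big(\sum_j\omega_j\theta_j-\dot{\mathcal R}\big)$, $k\ge1$. $\operatorname{sp}(\mathcal L)$ denotes its spectrum. *)

(* Defs.v *)
From Stdlib Require Import Reals Ranalysis5 Lra Lia Psatz ClassicalEpsilon.
From Coquelicot Require Import Coquelicot.
Open Scope R_scope.

Record constants := Constants {
  rho_l : R;
  mu_l : R;
  kappa : R;
  heat_cap : R;   (* fraktur c *)
  gas_cst : R;    (* fraktur R *)
  T_c : R;
  sigma_in : R;   (* sigma: surface tension at the inner interface *)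
  sigma_out : R;  (* sigma bar: surface tension at the outer interface *)
  rho_l_pos : 0 < rho_l;
  mu_l_pos : 0 < mu_l;
  kappa_pos : 0 < kappa;
  heat_cap_pos : 0 < heat_cap;
  gas_cst_pos : 0 < gas_cst;
  T_c_pos : 0 < T_c;
  sigma_in_pos : 0 < sigma_in;
  sigma_out_pos : 0 < sigma_out
}.

Definition gamma (P : constants) : R := 1 + gas_cst P / heat_cap P.

Definition V_bar (V : R) : R := 3 * V / (4 * PI).

(** Outer radius; [Rpower] is the usual power only for a positive base, and it
    is only used with [r > 0] and [V > 0]. *)
Definition outer_radius (V r : R) : R := Rpower (r ^ 3 + V_bar V) (/ 3).

Definition is_equilibrium (P : constants) (M V : R) (p : R * R) : Prop :=
  let rho := fst p in
  let r := snd p in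
  0 < rho /\ 0 < r /\
  4 * PI / 3 * rho * r ^ 3 = M /\
  rho = 2 / (gas_cst P * T_c P)
        * (sigma_in P / r + sigma_out P / outer_radius V r).

Definition equilibrium (P : constants) (M V : R) : R * R :=
  epsilon (inhabits (0, 0)) (is_equilibrium P M V).

Lemma V_bar_pos (V : R) : 0 < V -> 0 < V_bar V.
Proof.
intros HV; unfold V_bar; generalize PI_RGT_0; intros.
apply Rdiv_lt_0_compat; lra.
Qed.

Lemma outer_radius_pos (V r : R) : 0 < outer_radius V r.
Proof. apply exp_pos. Qed.

Lemma outer_radius_cube (V r : R) :
  0 < V -> 0 <= r -> outer_radius V r ^ 3 = r ^ 3 + V_bar V.
Proof.
intros HV Hr.
assert (Hb := V_bar_pos V HV).
assert (0 < r ^ 3 + V_bar V) by (assert (0 <= r ^ 3) by (apply pow_le; lra); lra).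
rewrite <- (Rpower_pow 3) by apply outer_radius_pos.
unfold outer_radius; rewrite Rpower_mult.
replace (/ 3 * INR 3) with 1 by (simpl; field).
now apply Rpower_1.
Qed.

(** The equilibrium radius solves [balance P V r = 3 M Rg T_c / (8 PI)]. *)
Definition balance (P : constants) (V r : R) : R :=
  r ^ 2 * (sigma_in P + sigma_out P * (r / outer_radius V r)).

Lemma balance_incr (P : constants) (V r1 r2 : R) :
  0 < V -> 0 < r1 -> r1 < r2 -> balance P V r1 < balance P V r2.
Proof.
intros HV H1 H12.
assert (Hb := V_bar_pos V HV).
assert (p1 := outer_radius_pos V r1); assert (p2 := outer_radius_pos V r2).
assert (c1 := outer_radius_cube V r1 HV (Rlt_le _ _ H1)).
assert (c2 := outer_radius_cube V r2 HV ltac:(lra)).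
assert (Hs := sigma_in_pos P); assert (Ht := sigma_out_pos P).
assert (Hq : r1 / outer_radius V r1 <= r2 / outer_radius V r2).
{ apply Rle_div_l; [easy|].
  replace (r2 / outer_radius V r2 * outer_radius V r1)
    with (r2 * outer_radius V r1 / outer_radius V r2) by (field; lra).
  apply Rle_div_r; [easy|].
  apply Rnot_lt_le; intros Hlt.
  assert (Hc : (r2 * outer_radius V r1) ^ 3 <= (r1 * outer_radius V r2) ^ 3).
  { apply pow_incr; split; [|lra]. apply Rmult_le_pos; lra. }
  rewrite !Rpow_mult_distr, c1, c2 in Hc.
  assert (0 < (r2 - r1) * (r2 ^ 2 + r2 * r1 + r1 ^ 2))
    by (apply Rmult_lt_0_compat; nra).
  nra. }
assert (0 < r1 / outer_radius V r1) by (apply Rdiv_lt_0_compat; lra).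
unfold balance.
assert (r1 ^ 2 < r2 ^ 2) by nra.
assert (0 < r1 ^ 2) by nra.
assert (sigma_out P * (r1 / outer_radius V r1)
        <= sigma_out P * (r2 / outer_radius V r2))
  by (apply Rmult_le_compat_l; lra).
assert (0 < sigma_out P * (r1 / outer_radius V r1))
  by (apply Rmult_lt_0_compat; lra).
apply Rlt_le_trans with
  (r2 ^ 2 * (sigma_in P + sigma_out P * (r1 / outer_radius V r1))).
- apply Rmult_lt_compat_r; lra.
- apply Rmult_le_compat_l; lra.
Qed.

Lemma balance_continuous (P : constants) (V r : R) :
  0 < V -> 0 <= r -> continuity_pt (balance P V) r.
Proof.
intros HV Hr.
assert (Hb := V_bar_pos V HV).
assert (0 < r ^ 3 + V_bar V) by (assert (0 <= r ^ 3) by (apply pow_le; lra); lra).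
apply derivable_continuous_pt, ex_derive_Reals_0.
unfold balance, outer_radius, Rpower.
auto_derive; repeat split; try lra.
apply Rgt_not_eq, exp_pos.
Qed.

Lemma is_equilibriumE (P : constants) (M V rho r : R) :
  0 < M -> 0 < V ->
  is_equilibrium P M V (rho, r) <->
  0 < r /\ rho = 3 * M / (4 * PI * r ^ 3) /\
  balance P V r = 3 * M * (gas_cst P * T_c P) / (8 * PI).
Proof.
intros HM HV.
assert (Hpi := PI_RGT_0).
assert (Hg := gas_cst_pos P); assert (HT := T_c_pos P).
assert (po := outer_radius_pos V r).
assert (HgT : 0 < gas_cst P * T_c P) by (apply Rmult_lt_0_compat; lra).
unfold is_equilibrium, balance; simpl fst; simpl snd.
split.
- intros (Hrho & Hr & E1 & E2).
  split; [easy|split].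
  + rewrite <- E1; field; lra.
  + rewrite <- E1, E2; field; lra.
- intros (Hr & E1 & E2).
  assert (0 < r ^ 3) by (apply pow_lt; lra).
  assert (HMe : M = r ^ 2 * (sigma_in P + sigma_out P * (r / outer_radius V r))
                    * (8 * PI) / (3 * (gas_cst P * T_c P)))
    by (rewrite E2; field; lra).
  split; [|split; [easy|split]].
  + rewrite E1; apply Rdiv_lt_0_compat; [lra|].
    apply Rmult_lt_0_compat; lra.
  + rewrite E1; field; lra.
  + rewrite E1, HMe; field; lra.
Qed.

Lemma equilibrium_exists_unique (P : constants) (M V : R) :
  0 < M -> 0 < V -> exists! p : R * R, is_equilibrium P M V p.
Proof.
intros HM HV.
assert (Hpi := PI_RGT_0).
assert (Hg := gas_cst_pos P); assert (HT := T_c_pos P).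
assert (Hs := sigma_in_pos P); assert (Ht := sigma_out_pos P).
set (K := 3 * M * (gas_cst P * T_c P) / (8 * PI)).
assert (HgT : 0 < gas_cst P * T_c P) by (apply Rmult_lt_0_compat; lra).
assert (HK : 0 < K).
{ unfold K; apply Rdiv_lt_0_compat; [|lra]. apply Rmult_lt_0_compat; lra. }
set (X := K / sigma_in P + 1).
assert (HKs : 0 < K / sigma_in P) by (apply Rdiv_lt_0_compat; lra).
assert (HX : K < balance P V X).
{ assert (0 < X / outer_radius V X)
    by (apply Rdiv_lt_0_compat; [unfold X; lra|apply outer_radius_pos]).
  assert (K = K / sigma_in P * sigma_in P) by (field; lra).
  assert (0 < sigma_out P * (X / outer_radius V X)) by (apply Rmult_lt_0_compat; lra).
  unfold balance.
  assert (K / sigma_in P < X ^ 2) by (unfold X; nra).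
  nra. }
destruct (IVT_interv (fun r => balance P V r - K) 0 X) as [r [[Hr0 HrX] Hr]].
- intros a Ha.
  apply continuity_pt_minus; [apply balance_continuous; lra|].
  apply continuity_pt_const; intros ? ?; reflexivity.
- unfold X; lra.
- unfold balance; rewrite pow_ne_zero by lia; lra.
- lra.
- assert (Hrp : 0 < r).
  { destruct Hr0 as [|<-]; [easy|].
    unfold balance in Hr; rewrite pow_ne_zero in Hr by lia; lra. }
  exists (3 * M / (4 * PI * r ^ 3), r); split.
  + apply is_equilibriumE; try easy.
    split; [easy|split; [easy|]]. fold K; lra.
  + intros [rho' r'] H'.
    apply is_equilibriumE in H'; try easy.
    destruct H' as (Hr' & -> & Hb'); fold K in Hb'.
    assert (r = r') as ->; [|easy].
    destruct (Rtotal_order r r') as [Hlt|[|Hlt]]; [exfalso|easy|exfalso].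
    * assert (Hi := balance_incr P V r r' HV Hrp Hlt); lra.
    * assert (Hi := balance_incr P V r' r HV Hr' Hlt); lra.
Qed.

Lemma equilibriumP (P : constants) (M V : R) :
  0 < M -> 0 < V -> is_equilibrium P M V (equilibrium P M V).
Proof.
intros HM HV; unfold equilibrium; apply epsilon_spec.
destruct (equilibrium_exists_unique P M V HM HV) as [p [Hp _]]; now exists p.
Qed.

Definition rho_dag (P : constants) (M V : R) : R := fst (equilibrium P M V).
Definition R_dag (P : constants) (M V : R) : R := snd (equilibrium P M V).

Definition R_bar_dag (P : constants) (M V : R) : R :=
  outer_radius V (R_dag P M V).

Definition R_tilde_dag (P : constants) (M V : R) : R :=
  R_dag P M V - R_dag P M V ^ 2 / R_bar_dag P M V.

Definition chi (P : constants) (M V : R) : R :=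
  kappa P / (R_dag P M V ^ 2 * rho_dag P M V * gamma P * heat_cap P).

Definition coefA (P : constants) (M V : R) : R :=
  2 * sigma_in P / R_dag P M V ^ 2
  + 2 * sigma_out P * R_dag P M V ^ 2 / R_bar_dag P M V ^ 4.

Definition coefB (P : constants) (M V : R) : R :=
  4 * mu_l P * V_bar V / (R_dag P M V * (R_dag P M V ^ 3 + V_bar V)).

(** [zeta], [xi] and [omega] are meaningful for indices [>= 1]. *)
Definition zeta (j : nat) : R := (INR j * PI) ^ 2.

(** [2 * sqrt 2] is 2^(3/2). *)
Definition xi (P : constants) (k : nat) : R :=
  (-1) ^ (k - 1) * (2 * sqrt 2) * (gamma P - 1)
  / (sqrt PI * gamma P * INR k).

Definition omega (P : constants) (M V : R) (j : nat) : R :=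
  - (R_dag P M V * chi P M V / rho_dag P M V) * sqrt (PI / 2)
  * (-1) ^ j * INR j.

Definition in_l2 (z : nat -> C) : Prop := ex_series (fun n => Cmod (z n) ^ 2).

Definition l2_norm (z : nat -> C) : R := sqrt (Series (fun n => Cmod (z n) ^ 2)).

Definition ex_Cseries (u : nat -> C) : Prop :=
  ex_series (fun n => Re (u n)) /\ ex_series (fun n => Im (u n)).

Definition Cseries (u : nat -> C) : C :=
  (Series (fun n => Re (u n)), Series (fun n => Im (u n))).

(** [D] is the domain of the operator [T], which maps [D] into l^2; the values
    of [T] outside [D] are irrelevant. *)
Definition in_resolvent_set (D : (nat -> C) -> Prop)
    (T : (nat -> C) -> nat -> C) (lambda : C) : Prop :=
  (forall y : nat -> C, in_l2 y ->
     exists! x : nat -> C,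
       D x /\ forall n, (lambda * x n - T x n)%C = y n) /\
  (exists K : R, forall x : nat -> C, D x ->
     l2_norm x <= K * l2_norm (fun n => (lambda * x n - T x n)%C)).

Definition in_spectrum (D : (nat -> C) -> Prop)
    (T : (nat -> C) -> nat -> C) (lambda : C) : Prop :=
  ~ in_resolvent_set D T lambda.

(** Indices are shifted by one: [z 0], [z 1], [z 2] are the density, radius and
    radial velocity coordinates, and theta_k is [z (2 + k)] for [k >= 1]. *)

Definition theta (z : nat -> C) (k : nat) : C := z (2 + k)%nat.

Definition heat_terms (P : constants) (M V : R) (z : nat -> C) (i : nat) : C :=
  (RtoC (omega P M V (S i)) * theta z (S i))%C.

Definition density_rate (P : constants) (M V : R) (z : nat -> C) : C :=
  (RtoC (3 * gamma P * rho_dag P M V / R_dag P M V)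
   * (Cseries (heat_terms P M V z) - z 2%nat))%C.

Definition opL (P : constants) (M V : R) (z : nat -> C) (n : nat) : C :=
  match n with
  | 0%nat => density_rate P M V z
  | 1%nat => z 2%nat
  | 2%nat =>
      (RtoC (/ (rho_l P * R_tilde_dag P M V))
       * (RtoC (gas_cst P * T_c P) * z 0%nat
          + RtoC (coefA P M V) * z 1%nat
          - RtoC (coefB P M V) * z 2%nat))%C
  | S (S k) =>
      (- (RtoC (chi P M V * zeta k) * theta z k)
       - RtoC (xi P k) * density_rate P M V z)%C
  end.

(** L is unbounded, and is taken on its maximal domain. Since [xi P] is square
    summable, this is the set of [z] in l^2 such that the sum over k of
    k^4 |theta_k|^2 is finite. *)
Definition domL (P : constants) (M V : R) (z : nat -> C) : Prop :=
  in_l2 z /\ ex_Cseries (heat_terms P M V z) /\ in_l2 (opL P M V z).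

Definition spL (P : constants) (M V : R) (lambda : C) : Prop :=
  in_spectrum (domL P M V) (opL P M V) lambda.

(** Supremum, in the extended reals, of the real parts of the nonzero
    elements of the spectrum; it is [m_infty] if there are none and [p_infty]
    if the real parts are not bounded above. *)
Definition spectral_sup (P : constants) (M V : R) : Rbar :=
  Lub_Rbar (fun r => exists lambda : C,
    spL P M V lambda /\ lambda <> RtoC 0 /\ r = Re lambda).

(* Main.v *)
Require Import Defs.
From Stdlib Require Import Reals Ranalysis5 Lra Lia Psatz FunctionalExtensionality.
From Coquelicot Require Import Coquelicot.
Open Scope R_scope.

(** Away from the poles [- chi zeta_k], the equation [lambda x - L x = y] fixes
    every heat mode, the density and the radius in terms of the two scalars
    [q = density_rate x] (the rate of change of the density) and [v = x 2] (the
    radial velocity). What remains is a 2 x 2 linear system with determinant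
    [[
      D(lambda) = F(lambda) (lambda^2 + m B lambda - m A) + a m Rg T_c,
      F(lambda) = 1 + 6 chi (gamma - 1) sum_k 1 / (lambda + chi zeta_k),
    ]]
    where [m = 1 / (rho_l R_tilde)], [a = 3 gamma rho / R] and [Rg] is the gas
    constant. So a nonzero [lambda] off the poles is in the spectrum exactly
    when [D(lambda) = 0] ([resolvent_of_char_fun], [spectrum_of_char_fun]). The
    coefficients of the reduction are of order [1 / k] and so square summable,
    and the Cauchy-Schwarz inequality bounds the inverse.

    Upper bound on the supremum ([spectrum_upper]). If [D(lambda) = 0] with
    [Im lambda <> 0], then [Im F] has the sign opposite to [Im lambda], which
    forces the imaginary part of the quadratic factor,
    [Im lambda (2 Re lambda + m B)], to have that opposite sign too; hence
    [Re lambda <= - m B / 2] ([char_fun_nonreal]). For real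
    [lambda >= - pi^2 chi / 2] one has [0 < F < (8/3) gamma], while the
    equilibrium relation gives [a Rg T_c >= 3 gamma A] ([restoring_dominates]);
    these keep [D] positive as long as [B |lambda| < A / 8] for negative
    [lambda] ([char_real_pos]). All of these thresholds are strictly negative,
    and they give [Theta0].

    Lower bound ([spectrum_lower]). When [lambda] decreases to [- pi^2 chi],
    the first term of [F] tends to plus infinity. If [V] is small, then
    [R_tilde] is small and [m] is large, so that the quadratic factor is
    negative between [- pi^2 chi] and [0] and [D] tends to minus infinity, whereas
    [D(0) > 0]. The intermediate value theorem gives an eigenvalue between
    [- pi^2 chi] and [0].

    The bounds on [chi] rest on [pi^2 chi] being a fixed multiple of [R], and
    on the equilibrium relation
    [R^2 (sigma + sigma_bar R / R_bar) = 3 M Rg T_c / (8 pi)] with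
    [0 < R / R_bar < 1]. *)

(** * Series and square summable sequences *)

Lemma ex_series_dominated (a b : nat -> R) :
  (forall n, 0 <= a n <= b n) -> ex_series b -> ex_series a.
Proof.
intros H Hb; apply (ex_series_le (V := R_CompleteNormedModule) a b); [|easy].
intros n; change (Rabs (a n) <= b n); rewrite Rabs_pos_eq; apply H.
Qed.

Lemma ex_series_Rscal (c : R) (a : nat -> R) :
  ex_series a -> ex_series (fun n => c * a n).
Proof. exact (ex_series_scal_l c a). Qed.

Lemma ex_series_Rplus (a b : nat -> R) :
  ex_series a -> ex_series b -> ex_series (fun n => a n + b n).
Proof. exact (ex_series_plus a b). Qed.

Lemma Series_nonneg (a : nat -> R) :
  (forall n, 0 <= a n) -> ex_series a -> 0 <= Series a.
Proof.
intros H Ha.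
replace 0 with (Series (fun n => 0 * a n)) by (rewrite Series_scal_l; ring).
apply Series_le; [|easy].
intros n; specialize (H n); lra.
Qed.

Lemma Series_ge_term (a : nat -> R) (n : nat) :
  (forall k, 0 <= a k) -> ex_series a -> a n <= Series a.
Proof.
intros H Ha.
rewrite (Series_incr_n a (S n)) by (easy || lia).
assert (Ht : 0 <= Series (fun k => a (S n + k)%nat)).
{ apply Series_nonneg; [easy|]. now apply ex_series_incr_n. }
simpl Init.Nat.pred.
assert (a n <= sum_f_R0 a n); [|lra].
destruct n as [|n]; simpl; [lra|].
assert (0 <= sum_f_R0 a n) by now apply cond_pos_sum.
lra.
Qed.

Lemma is_series_telescope :
  is_series (fun n => / INR (S n) - / INR (S (S n))) 1.
Proof.
assert (Hs : forall n, sum_n (fun n => / INR (S n) - / INR (S (S n))) n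
                       = 1 - / INR (S (S n))).
{ induction n as [|n IH].
  - rewrite sum_O; simpl; lra.
  - rewrite sum_Sn, IH. unfold plus; simpl plus.
    change (1 - / INR (S (S n)) + (/ INR (S (S n)) - / INR (S (S (S n))))
            = 1 - / INR (S (S (S n)))).
    ring. }
change (is_lim_seq (sum_n (fun n => / INR (S n) - / INR (S (S n)))) 1).
apply is_lim_seq_ext with (fun n => 1 - / INR (S (S n))).
{ intros n; now rewrite Hs. }
replace (Finite 1) with (Finite (1 - 0)) by (f_equal; ring).
apply is_lim_seq_minus'; [apply is_lim_seq_const|].
apply -> (is_lim_seq_incr_1 (fun n => / INR (S n)) 0).
apply -> (is_lim_seq_incr_1 (fun n => / INR n) 0).
replace (Finite 0) with (Rbar_inv p_infty) by easy.
apply is_lim_seq_inv; [apply is_lim_seq_INR|easy].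
Qed.

Lemma inv_sq_le_telescope (n : nat) :
  0 <= (/ INR (S n)) ^ 2 <= 2 * (/ INR (S n) - / INR (S (S n))).
Proof.
assert (H : 1 <= INR (S n)) by (rewrite S_INR; generalize (pos_INR n); lra).
rewrite (S_INR (S n)); set (x := INR (S n)) in *.
split; [apply pow2_ge_0|].
assert (E : 2 * (/ x - / (x + 1)) - (/ x) ^ 2 = (x - 1) / (x ^ 2 * (x + 1))).
{ field; lra. }
assert (0 <= (x - 1) / (x ^ 2 * (x + 1))); [|lra].
apply Rcomplements.Rdiv_le_0_compat; [lra|].
apply Rmult_lt_0_compat; [nra|lra].
Qed.

Lemma ex_series_inv_sq : ex_series (fun n => (/ INR (S n)) ^ 2).
Proof.
apply ex_series_dominated with (1 := inv_sq_le_telescope).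
apply ex_series_Rscal; eexists; apply is_series_telescope.
Qed.

(** Comparison with a telescoping series; this crude substitute for
    [pi^2 / 6] is precise enough because [restoring_dominates] leaves a margin. *)
Lemma Series_inv_sq_le : Series (fun n => (/ INR (S n)) ^ 2) <= 2.
Proof.
replace 2 with (2 * Series (fun n => / INR (S n) - / INR (S (S n)))).
- rewrite <- Series_scal_l; apply Series_le; [apply inv_sq_le_telescope|].
  apply ex_series_Rscal; eexists; apply is_series_telescope.
- rewrite (is_series_unique _ _ is_series_telescope); ring.
Qed.

Lemma ex_series_mult_l2 (a b : nat -> R) :
  (forall n, 0 <= a n) -> (forall n, 0 <= b n) ->
  ex_series (fun n => a n ^ 2) -> ex_series (fun n => b n ^ 2) ->
  ex_series (fun n => a n * b n).
Proof.
intros pa pb Ha Hb.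
apply ex_series_dominated with (fun n => a n ^ 2 + b n ^ 2).
- intros n; specialize (pa n); specialize (pb n).
  assert (0 <= a n * b n) by now apply Rmult_le_pos.
  assert (0 <= (a n - b n) ^ 2) by apply pow2_ge_0.
  lra || nra.
- now apply ex_series_Rplus.
Qed.

(** The series of [(t a_n - b_n)^2] is nonnegative; [t] is chosen to
    minimize it, which is where [0 < Series (a ^ 2)] enters. *)
Lemma Series_Cauchy_Schwarz (a b : nat -> R) :
  (forall n, 0 <= a n) -> (forall n, 0 <= b n) ->
  ex_series (fun n => a n ^ 2) -> ex_series (fun n => b n ^ 2) ->
  0 < Series (fun n => a n ^ 2) ->
  Series (fun n => a n * b n) ^ 2
  <= Series (fun n => a n ^ 2) * Series (fun n => b n ^ 2).
Proof.
intros pa pb Ha Hb HA.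
assert (Hab := ex_series_mult_l2 a b pa pb Ha Hb).
set (A := Series (fun n => a n ^ 2)) in *.
set (B := Series (fun n => b n ^ 2)).
set (S := Series (fun n => a n * b n)).
set (t := S / A).
assert (H : 0 <= Series (fun n => t ^ 2 * a n ^ 2
                                  + (- (2 * t) * (a n * b n) + b n ^ 2))).
{ apply Series_nonneg.
  - intros n; assert (0 <= (t * a n - b n) ^ 2) by apply pow2_ge_0; nra.
  - apply ex_series_Rplus; [now apply ex_series_Rscal|].
    apply ex_series_Rplus; [now apply ex_series_Rscal|easy]. }
rewrite Series_plus, Series_plus, !Series_scal_l in H;
  try (now apply ex_series_Rscal); try easy;
  [|apply ex_series_Rplus; [now apply ex_series_Rscal|easy]].
fold A B S in H.
assert (E : t ^ 2 * A + (- (2 * t) * S + B) = (A * B - S ^ 2) / A).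
{ unfold t; field; lra. }
rewrite E in H.
assert (0 <= (A * B - S ^ 2) / A * A) by (apply Rmult_le_pos; lra).
replace ((A * B - S ^ 2) / A * A) with (A * B - S ^ 2) in * by (field; lra).
lra.
Qed.

Lemma im_le_Cmod (c : C) : Rabs (Im c) <= Cmod c.
Proof.
apply Rle_trans with (2 := Rmax_Cmod c); apply Rmax_r.
Qed.

Lemma Cmod_le_Re_Im (c : C) : Cmod c <= Rabs (Re c) + Rabs (Im c).
Proof.
destruct c as [x y]; unfold Cmod; simpl fst; simpl snd; unfold Re, Im; simpl fst; simpl snd.
assert (0 <= Rabs x) by apply Rabs_pos; assert (0 <= Rabs y) by apply Rabs_pos.
rewrite <- (sqrt_pow2 (Rabs x + Rabs y)) by lra.
apply sqrt_le_1_alt.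
rewrite <- (pow2_abs x), <- (pow2_abs y); nra.
Qed.

Lemma ex_series_Re_Im_dominated (u : nat -> C) (b : nat -> R) :
  (forall n, Cmod (u n) <= b n) -> ex_series b ->
  ex_series (fun n => Rabs (Re (u n))) /\ ex_series (fun n => Rabs (Im (u n))).
Proof.
intros H Hb; split; apply ex_series_dominated with b; try easy;
  intros n; (split; [apply Rabs_pos|]); apply Rle_trans with (2 := H n).
- apply re_le_Cmod.
- apply im_le_Cmod.
Qed.

Lemma ex_Cseries_dominated (u : nat -> C) (b : nat -> R) :
  (forall n, Cmod (u n) <= b n) -> ex_series b -> ex_Cseries u.
Proof.
intros H Hb; destruct (ex_series_Re_Im_dominated u b H Hb).
split; now apply ex_series_Rabs.
Qed.

(** Estimating the real and the imaginary part separately costs the factor 2. *)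
Lemma Cmod_Cseries_le (u : nat -> C) (b : nat -> R) :
  (forall n, Cmod (u n) <= b n) -> ex_series b ->
  Cmod (Cseries u) <= 2 * Series b.
Proof.
intros H Hb; destruct (ex_series_Re_Im_dominated u b H Hb) as [H1 H2].
apply Rle_trans with (1 := Cmod_le_Re_Im _).
assert (Rabs (Re (Cseries u)) <= Series b).
{ apply Rle_trans with (1 := Series_Rabs _ H1).
  apply Series_le; [|easy]; intros n; split; [apply Rabs_pos|].
  apply Rle_trans with (2 := H n); apply re_le_Cmod. }
assert (Rabs (Im (Cseries u)) <= Series b).
{ apply Rle_trans with (1 := Series_Rabs _ H2).
  apply Series_le; [|easy]; intros n; split; [apply Rabs_pos|].
  apply Rle_trans with (2 := H n); apply im_le_Cmod. }
lra.
Qed.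

Lemma Cseries_ext (u v : nat -> C) :
  (forall n, u n = v n) -> Cseries u = Cseries v.
Proof. intros H; unfold Cseries; f_equal; apply Series_ext; intros n; now rewrite H. Qed.

Lemma Cseries_lin (c : C) (u v : nat -> C) :
  ex_Cseries u -> ex_Cseries v ->
  Cseries (fun n => u n - c * v n)%C = (Cseries u - c * Cseries v)%C.
Proof.
intros [Hu1 Hu2] [Hv1 Hv2]; destruct c as [x y].
unfold Cseries; apply injective_projections; simpl.
- rewrite (Series_ext _ (fun n => Re (u n) + (- x * Re (v n) + y * Im (v n))))
    by (intros n; unfold Re, Im; ring).
  rewrite !Series_plus, !Series_scal_l; try now apply ex_series_Rscal.
  + unfold Re, Im; ring.
  + easy.
  + apply ex_series_Rplus; now apply ex_series_Rscal.
- rewrite (Series_ext _ (fun n => Im (u n) + (- x * Im (v n) + - y * Re (v n))))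
    by (intros n; unfold Re, Im; ring).
  rewrite !Series_plus, !Series_scal_l; try now apply ex_series_Rscal.
  + unfold Re, Im; ring.
  + easy.
  + apply ex_series_Rplus; now apply ex_series_Rscal.
Qed.

Lemma ex_Cseries_lin (c : C) (u v : nat -> C) :
  ex_Cseries u -> ex_Cseries v -> ex_Cseries (fun n => u n - c * v n)%C.
Proof.
intros [Hu1 Hu2] [Hv1 Hv2]; destruct c as [x y]; split.
- apply ex_series_ext with (fun n => Re (u n) + (- x * Re (v n) + y * Im (v n))).
  + intros n; unfold Re, Im; simpl; ring.
  + repeat apply ex_series_Rplus; try apply ex_series_Rscal; easy.
- apply ex_series_ext with (fun n => Im (u n) + (- x * Im (v n) + - y * Re (v n))).
  + intros n; unfold Re, Im; simpl; ring.
  + repeat apply ex_series_Rplus; try apply ex_series_Rscal; easy.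
Qed.

Lemma in_l2_dominated (z : nat -> C) (b : nat -> R) :
  (forall n, Cmod (z n) <= b n) -> ex_series (fun n => b n ^ 2) -> in_l2 z.
Proof.
intros H Hb; apply ex_series_dominated with (2 := Hb); intros n.
split; [apply pow2_ge_0|].
apply pow_incr; split; [apply Cmod_ge_0|apply H].
Qed.

Lemma l2_norm_nonneg (z : nat -> C) : 0 <= l2_norm z.
Proof. apply sqrt_pos. Qed.

Lemma l2_norm_sq (z : nat -> C) :
  in_l2 z -> l2_norm z ^ 2 = Series (fun n => Cmod (z n) ^ 2).
Proof.
intros H; unfold l2_norm; apply pow2_sqrt, Series_nonneg; [|easy].
intros n; apply pow2_ge_0.
Qed.

Lemma Cmod_le_l2_norm (z : nat -> C) (n : nat) : in_l2 z -> Cmod (z n) <= l2_norm z.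
Proof.
intros H.
rewrite <- (sqrt_pow2 (Cmod (z n))) by apply Cmod_ge_0.
apply sqrt_le_1_alt.
apply (Series_ge_term (fun n => Cmod (z n) ^ 2)); [intros; apply pow2_ge_0|easy].
Qed.

Lemma ex_series_sq_lincomb (c d : R) (a b : nat -> R) :
  ex_series (fun n => a n ^ 2) -> ex_series (fun n => b n ^ 2) ->
  ex_series (fun n => (c * a n + d * b n) ^ 2) /\
  Series (fun n => (c * a n + d * b n) ^ 2)
  <= 2 * c ^ 2 * Series (fun n => a n ^ 2) + 2 * d ^ 2 * Series (fun n => b n ^ 2).
Proof.
intros Ha Hb.
assert (H : forall n, 0 <= (c * a n + d * b n) ^ 2
                      <= 2 * c ^ 2 * a n ^ 2 + 2 * d ^ 2 * b n ^ 2).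
{ intros n; split; [apply pow2_ge_0|].
  assert (0 <= (c * a n - d * b n) ^ 2) by apply pow2_ge_0; nra. }
assert (Hs : ex_series (fun n => 2 * c ^ 2 * a n ^ 2 + 2 * d ^ 2 * b n ^ 2)).
{ apply ex_series_Rplus; now apply ex_series_Rscal. }
split; [now apply ex_series_dominated with (1 := H)|].
rewrite <- !Series_scal_l, <- Series_plus by now apply ex_series_Rscal.
now apply Series_le.
Qed.

(** * The equilibrium and its coefficients *)

Lemma gamma_gt1 (P : constants) : 1 < gamma P.
Proof.
assert (0 < gas_cst P / heat_cap P)
  by (apply Rdiv_lt_0_compat; [apply gas_cst_pos|apply heat_cap_pos]).
unfold gamma; lra.
Qed.

Lemma equilibrium_eqs (P : constants) (M V : R) :
  0 < M -> 0 < V ->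
  0 < R_dag P M V /\ 0 < rho_dag P M V /\
  rho_dag P M V = 3 * M / (4 * PI * R_dag P M V ^ 3) /\
  gas_cst P * T_c P * rho_dag P M V
    = 2 * (sigma_in P / R_dag P M V + sigma_out P / R_bar_dag P M V) /\
  balance P V (R_dag P M V) = 3 * M * (gas_cst P * T_c P) / (8 * PI).
Proof.
intros HM HV.
assert (H := equilibriumP P M V HM HV).
unfold R_bar_dag, R_dag, rho_dag; destruct (equilibrium P M V) as [rho r].
simpl fst; simpl snd.
assert (H' := proj1 (is_equilibriumE P M V rho r HM HV) H).
destruct H as (Hrho & Hr & E1 & E2); destruct H' as (_ & E3 & E4).
simpl fst in *; simpl snd in *.
repeat split; try easy.
rewrite E2; field.
generalize (outer_radius_pos V r) (gas_cst_pos P) (T_c_pos P); lra.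
Qed.

Lemma R_dag_pos (P : constants) (M V : R) : 0 < M -> 0 < V -> 0 < R_dag P M V.
Proof. intros HM HV; apply (equilibrium_eqs P M V HM HV). Qed.

Lemma rho_dag_pos (P : constants) (M V : R) : 0 < M -> 0 < V -> 0 < rho_dag P M V.
Proof. intros HM HV; apply (equilibrium_eqs P M V HM HV). Qed.

Lemma R_dag_lt_R_bar_dag (P : constants) (M V : R) :
  0 < M -> 0 < V -> R_dag P M V < R_bar_dag P M V.
Proof.
intros HM HV.
assert (Hr := R_dag_pos P M V HM HV).
assert (Hb := outer_radius_pos V (R_dag P M V)).
assert (Hc := outer_radius_cube V (R_dag P M V) HV (Rlt_le _ _ Hr)).
assert (Hv := V_bar_pos V HV).
unfold R_bar_dag; set (r := R_dag P M V) in *; set (s := outer_radius V r) in *.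
apply Rnot_le_lt; intros Hle.
assert (s ^ 3 <= r ^ 3) by (apply pow_incr; lra).
lra.
Qed.

(** Expanding the difference of cubes in [R_bar ^ 3 - R ^ 3 = V_bar]. *)
Lemma R_tilde_dag_bounds (P : constants) (M V : R) :
  0 < M -> 0 < V ->
  0 < R_tilde_dag P M V /\ R_tilde_dag P M V * R_dag P M V ^ 2 <= V_bar V.
Proof.
intros HM HV.
assert (Hr := R_dag_pos P M V HM HV).
assert (Hlt := R_dag_lt_R_bar_dag P M V HM HV).
assert (Hc := outer_radius_cube V (R_dag P M V) HV (Rlt_le _ _ Hr)).
fold (R_bar_dag P M V) in Hc; unfold R_tilde_dag.
set (r := R_dag P M V) in *; set (s := R_bar_dag P M V) in *.
assert (E : r - r ^ 2 / s = (r / s) * (s - r)) by (field; lra).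
assert (H0 : 0 < r / s) by (apply Rdiv_lt_0_compat; lra).
assert (H1 : r / s <= 1) by (apply Rle_div_l; lra).
rewrite E; split; [apply Rmult_lt_0_compat; lra|].
assert (r / s * (s - r) <= 1 * (s - r)) by (apply Rmult_le_compat_r; lra).
assert ((s - r) * r ^ 2 <= V_bar V).
{ replace (V_bar V) with ((s - r) * (s ^ 2 + s * r + r ^ 2)) by (rewrite <- (Rplus_minus_l (r ^ 3) (V_bar V)), <- Hc; ring).
  apply Rmult_le_compat_l; nra. }
assert (0 <= r ^ 2) by apply pow2_ge_0.
apply Rle_trans with (2 := H2).
apply Rmult_le_compat_r; lra.
Qed.

Lemma chi_pos (P : constants) (M V : R) : 0 < M -> 0 < V -> 0 < chi P M V.
Proof.
intros HM HV; unfold chi.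
assert (Hr := R_dag_pos P M V HM HV); assert (Hp := rho_dag_pos P M V HM HV).
assert (Hg := gamma_gt1 P); assert (Hh := heat_cap_pos P).
apply Rdiv_lt_0_compat; [apply kappa_pos|].
repeat apply Rmult_lt_0_compat; try apply pow_lt; lra.
Qed.

Lemma coefA_lower (P : constants) (M V : R) :
  0 < M -> 0 < V -> 2 * sigma_in P / R_dag P M V ^ 2 < coefA P M V.
Proof.
intros HM HV; unfold coefA.
assert (Hr := R_dag_pos P M V HM HV).
assert (Hlt := R_dag_lt_R_bar_dag P M V HM HV); assert (Hs := sigma_out_pos P).
assert (0 < 2 * sigma_out P * R_dag P M V ^ 2 / R_bar_dag P M V ^ 4); [|lra].
apply Rdiv_lt_0_compat; [|apply pow_lt; lra].
apply Rmult_lt_0_compat; [lra|apply pow_lt; lra].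
Qed.

Lemma coefA_pos (P : constants) (M V : R) : 0 < M -> 0 < V -> 0 < coefA P M V.
Proof.
intros HM HV; apply Rlt_trans with (2 := coefA_lower P M V HM HV).
assert (Hr := R_dag_pos P M V HM HV); assert (Hs := sigma_in_pos P).
apply Rdiv_lt_0_compat; [lra|apply pow_lt; lra].
Qed.

Lemma coefB_pos (P : constants) (M V : R) : 0 < M -> 0 < V -> 0 < coefB P M V.
Proof.
intros HM HV; unfold coefB.
assert (Hr := R_dag_pos P M V HM HV); assert (Hm := mu_l_pos P).
assert (Hv := V_bar_pos V HV).
assert (0 < R_dag P M V ^ 3) by (apply pow_lt; lra).
apply Rdiv_lt_0_compat; [|apply Rmult_lt_0_compat; lra].
apply Rmult_lt_0_compat; lra.
Qed.

(** The factor [a] in [density_rate]. *)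
Definition gain (P : constants) (M V : R) : R :=
  3 * gamma P * rho_dag P M V / R_dag P M V.

(** The factor [m] in the radial momentum equation. *)
Definition inv_inertia (P : constants) (M V : R) : R :=
  / (rho_l P * R_tilde_dag P M V).

Lemma gain_pos (P : constants) (M V : R) : 0 < M -> 0 < V -> 0 < gain P M V.
Proof.
intros HM HV; unfold gain.
assert (Hr := R_dag_pos P M V HM HV); assert (Hp := rho_dag_pos P M V HM HV).
assert (Hg := gamma_gt1 P).
apply Rdiv_lt_0_compat; [|lra].
repeat apply Rmult_lt_0_compat; lra.
Qed.

Lemma inv_inertia_pos (P : constants) (M V : R) :
  0 < M -> 0 < V -> 0 < inv_inertia P M V.
Proof.
intros HM HV; apply Rinv_0_lt_compat, Rmult_lt_0_compat; [apply rho_l_pos|].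
apply (R_tilde_dag_bounds P M V HM HV).
Qed.

(** By the equilibrium relation the left side is
    [6 gamma (sigma / R^2 + sigma_bar / (R R_bar))], and [R < R_bar]
    compares it with [A] term by term. *)
Lemma restoring_dominates (P : constants) (M V : R) :
  0 < M -> 0 < V ->
  3 * gamma P * coefA P M V <= gain P M V * (gas_cst P * T_c P).
Proof.
intros HM HV.
destruct (equilibrium_eqs P M V HM HV) as (Hr & _ & _ & E & _).
assert (Hlt := R_dag_lt_R_bar_dag P M V HM HV).
assert (Hs := sigma_in_pos P); assert (Ho := sigma_out_pos P).
assert (Hg := gamma_gt1 P).
unfold gain, coefA.
set (r := R_dag P M V) in *; set (s := R_bar_dag P M V) in *.
replace (3 * gamma P * rho_dag P M V / r * (gas_cst P * T_c P))
  with (3 * gamma P * ((gas_cst P * T_c P * rho_dag P M V) / r)) by (field; lra).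
rewrite E.
apply Rmult_le_compat_l; [lra|].
replace (2 * (sigma_in P / r + sigma_out P / s) / r)
  with (2 * sigma_in P / r ^ 2 + 2 * sigma_out P * (/ (r * s))) by (field; lra).
apply Rplus_le_compat_l.
unfold Rdiv; rewrite Rmult_assoc.
apply Rmult_le_compat_l; [lra|].
apply (Rle_div_l (r ^ 2) (/ (r * s)) (s ^ 4)); [apply pow_lt; lra|].
replace (/ (r * s) * s ^ 4) with (s ^ 3 / r) by (field; lra).
apply (Rle_div_r (r ^ 2) (s ^ 3) r); [lra|].
replace (r ^ 2 * r) with (r ^ 3) by ring.
apply pow_incr; lra.
Qed.

(** The dependence on the mode cancels in the product: this is why the modes
    enter the characteristic equation only through the sum of
    [1 / (lambda + chi zeta_k)]. *)
Lemma gain_omega_xi (P : constants) (M V : R) (i : nat) :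
  0 < M -> 0 < V ->
  gain P M V * (omega P M V (S i) * xi P (S i)) = 6 * chi P M V * (gamma P - 1).
Proof.
intros HM HV; unfold gain, omega, xi.
assert (Hr := R_dag_pos P M V HM HV); assert (Hp := rho_dag_pos P M V HM HV).
assert (Hg := gamma_gt1 P); assert (Hpi := PI_RGT_0).
assert (Hi : 0 < INR (S i)) by (apply lt_0_INR; lia).
assert (Hsp : 0 < sqrt PI) by now apply sqrt_lt_R0.
assert (Hs2 : 0 < sqrt 2) by (apply sqrt_lt_R0; lra).
rewrite sqrt_div by lra.
replace (S i - 1)%nat with i by lia.
assert (Hm : (-1) ^ S i * (-1) ^ i = -1).
{ simpl; rewrite Rmult_assoc, <- Rpow_mult_distr.
  replace (-1 * -1) with 1 by ring; rewrite pow1; ring. }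
transitivity (- ((-1) ^ S i * (-1) ^ i) * (6 * chi P M V * (gamma P - 1))).
- field; lra.
- rewrite Hm; ring.
Qed.

(** * Reduction of the resolvent equation to two scalars *)

Definition mode_shift (P : constants) (M V : R) (lambda : C) (k : nat) : C :=
  (lambda + RtoC (chi P M V * zeta k))%C.

(** Quantitative distance to the poles. The growth in [INR (S i) ^ 2] makes the
    inverses of the shifts compensate the growth of [omega]. *)
Definition off_modes (P : constants) (M V : R) (lambda : C) (delta : R) : Prop :=
  0 < delta /\
  forall i, delta * INR (S i) ^ 2 <= Cmod (mode_shift P M V lambda (S i)).

Definition heat_factor (P : constants) (M V : R) (lambda : C) : C :=
  (1 + RtoC (6 * chi P M V * (gamma P - 1))
       * Cseries (fun i => / mode_shift P M V lambda (S i)))%C.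

Definition oscillator (P : constants) (M V : R) (lambda : C) : C :=
  (lambda * lambda + RtoC (inv_inertia P M V * coefB P M V) * lambda
   - RtoC (inv_inertia P M V * coefA P M V))%C.

(** The determinant of [reduced_system]. *)
Definition char_fun (P : constants) (M V : R) (lambda : C) : C :=
  (heat_factor P M V lambda * oscillator P M V lambda
   + RtoC (gain P M V * (inv_inertia P M V * (gas_cst P * T_c P))))%C.

(** Contribution of the data [y] to the series of [omega_k theta_k], once the heat
    equations are solved for the modes. *)
Definition heat_source (P : constants) (M V : R) (lambda : C) (y : nat -> C) : C :=
  Cseries (fun i => RtoC (omega P M V (S i)) * theta y (S i)
                    / mode_shift P M V lambda (S i))%C.

(** Right side of the momentum equation after multiplication by [lambda] and
    elimination of the density and of the radius. *)
Definition force (P : constants) (M V : R) (lambda : C) (y : nat -> C) : C :=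
  (lambda * y 2%nat
   + RtoC (inv_inertia P M V) * (RtoC (gas_cst P * T_c P) * y 0%nat
                                 + RtoC (coefA P M V) * y 1%nat))%C.

(** The solution of [lambda x - L x = y] in terms of its density rate [q] and
    velocity [v]. *)
Definition eliminated (P : constants) (M V : R) (lambda q v : C)
    (y : nat -> C) (n : nat) : C :=
  match n with
  | 0%nat => ((q + y 0%nat) / lambda)%C
  | 1%nat => ((v + y 1%nat) / lambda)%C
  | 2%nat => v
  | S (S k) => ((theta y k - RtoC (xi P k) * q) / mode_shift P M V lambda k)%C
  end.

(** The conditions on [q] and [v] under which [eliminated] solves the resolvent
    equation: consistency of [q] with [density_rate], and the momentum
    equation. *)
Definition reduced_system (P : constants) (M V : R) (lambda q v : C)
    (y : nat -> C) : Prop :=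
  (heat_factor P M V lambda * q + RtoC (gain P M V) * v
   = RtoC (gain P M V) * heat_source P M V lambda y)%C /\
  (oscillator P M V lambda * v
   - RtoC (inv_inertia P M V * (gas_cst P * T_c P)) * q
   = force P M V lambda y)%C.

Lemma INR_S_ge1 (i : nat) : 1 <= INR (S i).
Proof. rewrite S_INR; generalize (pos_INR i); lra. Qed.

Lemma off_modes_neq0 (P : constants) (M V : R) (lambda : C) (delta : R) (i : nat) :
  off_modes P M V lambda delta -> mode_shift P M V lambda (S i) <> 0.
Proof.
intros [Hd H] E; specialize (H i); rewrite E, Cmod_0 in H.
assert (Hi := INR_S_ge1 i).
assert (0 < delta * INR (S i) ^ 2); [|lra].
apply Rmult_lt_0_compat; [easy|apply pow_lt; lra].
Qed.

Lemma Cmod_div_mode_shift (P : constants) (M V : R) (lambda z : C) (delta b : R)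
    (i : nat) :
  off_modes P M V lambda delta -> Cmod z <= b ->
  Cmod (z / mode_shift P M V lambda (S i))%C <= b / delta * (/ INR (S i)) ^ 2.
Proof.
intros H Hz; assert (Hn := off_modes_neq0 P M V lambda delta i H).
assert (Hi := INR_S_ge1 i).
destruct H as [Hd H]; specialize (H i).
rewrite Cmod_div by easy.
assert (Hp : 0 < delta * INR (S i) ^ 2)
  by (apply Rmult_lt_0_compat; [easy|apply pow_lt; lra]).
replace (b / delta * (/ INR (S i)) ^ 2) with (b * / (delta * INR (S i) ^ 2))
  by (field; lra).
apply Rmult_le_compat; [apply Cmod_ge_0| |easy|].
- left; apply Rinv_0_lt_compat; lra.
- now apply Rinv_le_contravar.
Qed.

Lemma omega_abs (P : constants) (M V : R) (i : nat) :
  Rabs (omega P M V (S i)) = Rabs (omega P M V 1) * INR (S i).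
Proof.
unfold omega; rewrite !Rabs_mult, !pow_1_abs.
rewrite (Rabs_pos_eq (INR (S i))) by apply pos_INR.
simpl (INR 1); rewrite Rabs_R1; ring.
Qed.

Lemma xi_abs_le (P : constants) (i : nat) : Rabs (xi P (S i)) <= Rabs (xi P 1).
Proof.
unfold xi, Rdiv; rewrite !Rabs_mult, !pow_1_abs.
assert (Hi := INR_S_ge1 i).
apply Rmult_le_compat_l.
{ repeat apply Rmult_le_pos; try apply Rabs_pos; lra. }
assert (Hg := gamma_gt1 P).
assert (Hp : 0 < sqrt PI * gamma P).
{ apply Rmult_lt_0_compat; [apply sqrt_lt_R0, PI_RGT_0|lra]. }
simpl (INR 1); rewrite !Rabs_pos_eq.
- apply Rinv_le_contravar; [lra|]. apply Rmult_le_compat_l; lra.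
- left; apply Rinv_0_lt_compat; lra.
- left; apply Rinv_0_lt_compat, Rmult_lt_0_compat; lra.
Qed.

Lemma Cmod_heat_term_le (P : constants) (M V : R) (lambda z : C) (delta : R)
    (i : nat) :
  off_modes P M V lambda delta ->
  Cmod (RtoC (omega P M V (S i)) * z / mode_shift P M V lambda (S i))%C
  <= Rabs (omega P M V 1) / delta * (/ INR (S i) * Cmod z).
Proof.
intros H; assert (Hi := INR_S_ge1 i).
apply Rle_trans with (1 := Cmod_div_mode_shift P M V lambda _ delta _ i H (Rle_refl _)).
rewrite Cmod_mult, Cmod_R, omega_abs.
apply Req_le; destruct H as [Hd _]; field; lra.
Qed.

Lemma in_l2_theta (y : nat -> C) :
  in_l2 y -> ex_series (fun i => Cmod (theta y (S i)) ^ 2).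
Proof.
intros H; apply (ex_series_incr_n (fun n => Cmod (y n) ^ 2) 3) in H.
exact H.
Qed.

Lemma Series_theta_le (y : nat -> C) :
  in_l2 y -> Series (fun i => Cmod (theta y (S i)) ^ 2) <= l2_norm y ^ 2.
Proof.
intros H; rewrite l2_norm_sq by easy.
rewrite (Series_incr_n (fun n => Cmod (y n) ^ 2) 3) by (easy || lia).
assert (0 <= sum_f_R0 (fun n => Cmod (y n) ^ 2) (Init.Nat.pred 3)).
{ apply cond_pos_sum; intros n; apply pow2_ge_0. }
change (Series (fun i => Cmod (theta y (S i)) ^ 2))
  with (Series (fun k => Cmod (y (3 + k)%nat) ^ 2)).
lra.
Qed.

Lemma inv_INR_nonneg (n : nat) : 0 <= / INR (S n).
Proof. left; apply Rinv_0_lt_compat; generalize (INR_S_ge1 n); lra. Qed.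

Lemma ex_series_heat_bound (P : constants) (M V delta : R) (y : nat -> C) :
  in_l2 y ->
  ex_series (fun i => Rabs (omega P M V 1) / delta
                      * (/ INR (S i) * Cmod (theta y (S i)))).
Proof.
intros Hy; apply ex_series_Rscal, ex_series_mult_l2.
- apply inv_INR_nonneg.
- intros; apply Cmod_ge_0.
- apply ex_series_inv_sq.
- now apply in_l2_theta.
Qed.

Lemma ex_heat_source (P : constants) (M V : R) (lambda : C) (delta : R)
    (y : nat -> C) :
  off_modes P M V lambda delta -> in_l2 y ->
  ex_Cseries (fun i => RtoC (omega P M V (S i)) * theta y (S i)
                       / mode_shift P M V lambda (S i))%C.
Proof.
intros H Hy.
apply ex_Cseries_dominated with (2 := ex_series_heat_bound P M V delta y Hy).
intros i; now apply Cmod_heat_term_le.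
Qed.

Lemma Series_inv_sq_pos : 0 < Series (fun n => (/ INR (S n)) ^ 2).
Proof.
apply Rlt_le_trans with ((/ INR 1) ^ 2).
- simpl; lra.
- apply (Series_ge_term (fun n => (/ INR (S n)) ^ 2) 0).
  + intros; apply pow2_ge_0.
  + apply ex_series_inv_sq.
Qed.

(** The terms are at most a multiple of [Cmod (theta y k) / k], so that the
    Cauchy-Schwarz inequality applies. *)
Lemma heat_source_bound (P : constants) (M V : R) (lambda : C) (delta : R)
    (y : nat -> C) :
  off_modes P M V lambda delta -> in_l2 y ->
  Cmod (heat_source P M V lambda y)
  <= 4 * (Rabs (omega P M V 1) / delta) * l2_norm y.
Proof.
intros H Hy.
apply Rle_trans with (1 := Cmod_Cseries_le _ _
  (fun i => Cmod_heat_term_le P M V lambda (theta y (S i)) delta i H)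
  (ex_series_heat_bound P M V delta y Hy)).
rewrite Series_scal_l.
assert (Hc : 0 <= Rabs (omega P M V 1) / delta).
{ apply Rcomplements.Rdiv_le_0_compat; [apply Rabs_pos|apply H]. }
assert (Hs : Series (fun i => / INR (S i) * Cmod (theta y (S i))) <= 2 * l2_norm y).
{ assert (Hcs := Series_Cauchy_Schwarz (fun i => / INR (S i))
    (fun i => Cmod (theta y (S i))) inv_INR_nonneg (fun i => Cmod_ge_0 _)
    ex_series_inv_sq (in_l2_theta y Hy) Series_inv_sq_pos).
  assert (H1 := Series_inv_sq_le); assert (H2 := Series_theta_le y Hy).
  assert (H3 := l2_norm_nonneg y); assert (H4 := Series_inv_sq_pos).
  apply Rnot_lt_le; intros Hlt.
  assert (0 <= Series (fun i => Cmod (theta y (S i)) ^ 2)).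
  { apply Series_nonneg; [intros; apply pow2_ge_0|now apply in_l2_theta]. }
  apply (Rlt_irrefl (Series (fun i => / INR (S i) * Cmod (theta y (S i))) ^ 2)).
  apply Rle_lt_trans with (1 := Hcs).
  apply Rle_lt_trans with (2 * l2_norm y ^ 2).
  - now apply Rmult_le_compat; try lra.
  - nra. }
nra.
Qed.

Lemma ex_heat_factor (P : constants) (M V : R) (lambda : C) (delta : R) :
  off_modes P M V lambda delta ->
  ex_Cseries (fun i => / mode_shift P M V lambda (S i))%C.
Proof.
intros H; apply ex_Cseries_dominated with (fun i => 1 / delta * (/ INR (S i)) ^ 2).
- intros i.
  replace (/ mode_shift P M V lambda (S i))%C
    with (RtoC 1 / mode_shift P M V lambda (S i))%C by (unfold Cdiv; ring).
  apply Cmod_div_mode_shift; [easy|]. rewrite Cmod_1; lra.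
- apply ex_series_Rscal, ex_series_inv_sq.
Qed.

Lemma density_rate_eliminated (P : constants) (M V : R) (lambda q v : C)
    (delta : R) (y : nat -> C) :
  0 < M -> 0 < V -> off_modes P M V lambda delta -> in_l2 y ->
  ex_Cseries (heat_terms P M V (eliminated P M V lambda q v y)) /\
  density_rate P M V (eliminated P M V lambda q v y)
  = (RtoC (gain P M V) * heat_source P M V lambda y
     - (heat_factor P M V lambda - 1) * q - RtoC (gain P M V) * v)%C.
Proof.
intros HM HV H Hy.
assert (Hg := gain_pos P M V HM HV).
assert (Hgc : RtoC (gain P M V) <> 0) by (intros E; apply RtoC_inj in E; lra).
set (c := 6 * chi P M V * (gamma P - 1)).
assert (Ht : forall i, heat_terms P M V (eliminated P M V lambda q v y) i
  = (RtoC (omega P M V (S i)) * theta y (S i) / mode_shift P M V lambda (S i)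
     - (q * RtoC (c / gain P M V)) * / mode_shift P M V lambda (S i))%C).
{ intros i; assert (Hn := off_modes_neq0 P M V lambda delta i H).
  assert (E : RtoC (c / gain P M V) = (RtoC (omega P M V (S i)) * RtoC (xi P (S i)))%C).
  { rewrite <- RtoC_mult; f_equal; unfold c.
    rewrite <- (gain_omega_xi P M V i) by easy; field; lra. }
  rewrite E; unfold heat_terms.
  change (theta (eliminated P M V lambda q v y) (S i))
    with ((theta y (S i) - RtoC (xi P (S i)) * q) / mode_shift P M V lambda (S i))%C.
  field; easy. }
assert (Hu := ex_heat_source P M V lambda delta y H Hy).
assert (Hd := ex_heat_factor P M V lambda delta H).
split.
- rewrite (functional_extensionality _ _ Ht); now apply ex_Cseries_lin.
- unfold density_rate; fold (gain P M V).
  rewrite (Cseries_ext _ _ Ht), Cseries_lin by easy.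
  unfold heat_factor, heat_source; fold c; simpl (eliminated P M V lambda q v y 2).
  rewrite RtoC_div by lra. field; easy.
Qed.

(** The factor [/ INR (S n)] stands for the decay of [xi_k / (lambda + chi zeta_k)];
    one bound for all coordinates, of the form taken by [in_l2_bound], avoids
    treating the first three separately. *)
Lemma eliminated_bound (P : constants) (M V : R) (lambda : C) (delta : R) :
  lambda <> 0 -> off_modes P M V lambda delta ->
  exists K, 0 <= K /\ forall q v y n,
    Cmod (eliminated P M V lambda q v y n)
    <= K * Cmod (y n) + K * (Cmod q + Cmod v) * / INR (S n).
Proof.
intros Hl H.
assert (Hlp : 0 < / Cmod lambda) by now apply Rinv_0_lt_compat, Cmod_gt_0.
assert (Hd : 0 < / delta) by (apply Rinv_0_lt_compat, H).
set (x := Rabs (xi P 1)); assert (Hx : 0 <= x) by apply Rabs_pos.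
assert (Hxd : 0 <= 4 * x * / delta) by (apply Rmult_le_pos; lra).
exists (2 * / Cmod lambda + 3 + / delta + 4 * x * / delta).
split; [lra|]; intros q v y n.
set (K := 2 * / Cmod lambda + 3 + / delta + 4 * x * / delta).
assert (Hq := Cmod_ge_0 q); assert (Hv := Cmod_ge_0 v); assert (Hy := Cmod_ge_0 (y n)).
assert (HKy : forall t, 0 <= t -> t <= K -> t * Cmod (y n) <= K * Cmod (y n))
  by (intros; apply Rmult_le_compat_r; easy).
assert (HKq : forall t, 0 <= t <= K ->
  t * (Cmod q + Cmod v) <= K * (Cmod q + Cmod v))
  by (intros; apply Rmult_le_compat_r; lra).
destruct n as [|[|[|i]]].
- simpl eliminated; rewrite Cmod_div by easy; simpl INR; rewrite Rinv_1.
  assert (H1 := HKy (/ Cmod lambda) ltac:(lra) ltac:(unfold K; lra)).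
  assert (H2 := HKq (/ Cmod lambda) ltac:(unfold K; lra)).
  apply Rle_trans with ((Cmod q + Cmod (y 0%nat)) * / Cmod lambda).
  { apply Rmult_le_compat_r; [lra|apply Cmod_triangle]. }
  nra.
- simpl eliminated; rewrite Cmod_div by easy; simpl INR.
  assert (H1 := HKy (/ Cmod lambda) ltac:(lra) ltac:(unfold K; lra)).
  assert (H2 := HKq (2 * / Cmod lambda) ltac:(unfold K; lra)).
  apply Rle_trans with ((Cmod v + Cmod (y 1%nat)) * / Cmod lambda).
  { apply Rmult_le_compat_r; [lra|apply Cmod_triangle]. }
  nra.
- simpl eliminated; simpl INR.
  assert (H1 := HKy 0 ltac:(lra) ltac:(unfold K; lra)).
  assert (H2 := HKq 3 ltac:(unfold K; lra)).
  lra.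
- assert (Hn := off_modes_neq0 P M V lambda delta i H).
  assert (Hi := INR_S_ge1 i).
  assert (Hxi := xi_abs_le P i); fold x in Hxi.
  change (eliminated P M V lambda q v y (S (S (S i))))
    with ((y (S (S (S i))) - RtoC (xi P (S i)) * q) / mode_shift P M V lambda (S i))%C.
  assert (Hb : Cmod (y (S (S (S i))) - RtoC (xi P (S i)) * q)%C
               <= Cmod (y (S (S (S i)))) + x * Cmod q).
  { unfold Cminus; apply Rle_trans with (1 := Cmod_triangle _ _).
    rewrite Cmod_opp, Cmod_mult, Cmod_R.
    apply Rplus_le_compat_l, Rmult_le_compat_r; easy. }
  apply Rle_trans with (1 := Cmod_div_mode_shift P M V lambda _ delta _ i H Hb).
  set (w := Cmod (y (S (S (S i))))) in *.
  assert (H0 := inv_INR_nonneg i).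
  assert (Hi1 : / INR (S i) <= 1) by (rewrite <- Rinv_1; apply Rinv_le_contravar; lra).
  assert (Hi4 : (/ INR (S i)) ^ 2 <= 4 * / INR (S (S (S (S i))))).
  { apply Rle_trans with (/ INR (S i)); [nra|].
    rewrite !(S_INR (S _)); set (t := INR (S i)) in *.
    replace (4 * / (t + 1 + 1 + 1)) with (/ ((t + 3) / 4)) by (field; lra).
    apply Rinv_le_contravar; lra. }
  set (e := / INR (S (S (S (S i))))) in *; set (s := (/ INR (S i)) ^ 2) in *.
  assert (Hs : 0 <= s <= 1) by (unfold s; split; [apply pow2_ge_0|nra]).
  assert (H1 := HKy (/ delta) ltac:(lra) ltac:(unfold K; lra)).
  assert (H2 := HKq (4 * x * / delta) ltac:(unfold K; lra)).
  replace ((w + x * Cmod q) / delta * s)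
    with (/ delta * w * s + x * / delta * Cmod q * s) by (unfold Rdiv; ring).
  apply Rplus_le_compat.
  + apply Rle_trans with (2 := H1).
    rewrite <- (Rmult_1_r (/ delta * w)) at 2.
    apply Rmult_le_compat_l; [apply Rmult_le_pos; lra|easy].
  + apply Rle_trans with (x * / delta * Cmod q * (4 * e)).
    * apply Rmult_le_compat_l; [|easy].
      apply Rmult_le_pos; [apply Rmult_le_pos; lra|easy].
    * replace (x * / delta * Cmod q * (4 * e)) with (4 * x * / delta * Cmod q * e) by ring.
      apply Rmult_le_compat_r; [lra|].
      apply Rle_trans with (2 := H2). apply Rmult_le_compat_l; lra.
Qed.

Lemma in_l2_bound (K N : R) (z y : nat -> C) :
  0 <= K -> 0 <= N -> in_l2 y ->
  (forall n, Cmod (z n) <= K * Cmod (y n) + K * N * / INR (S n)) ->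
  in_l2 z /\ l2_norm z <= 2 * K * (l2_norm y + 2 * N).
Proof.
intros HK HN Hy Hz.
destruct (ex_series_sq_lincomb K (K * N) (fun n => Cmod (y n)) (fun n => / INR (S n))
           Hy ex_series_inv_sq) as [H1 H2].
assert (Hz2 := in_l2_dominated z _ Hz H1).
split; [easy|].
assert (Hn := l2_norm_nonneg y).
assert (0 <= K * (l2_norm y + 2 * N)) by (apply Rmult_le_pos; lra).
apply Rsqr_incr_0_var; [|lra].
rewrite !Rsqr_pow2, l2_norm_sq by easy.
apply Rle_trans with (Series (fun n => (K * Cmod (y n) + K * N * / INR (S n)) ^ 2)).
{ apply Series_le; [|easy]; intros n; split; [apply pow2_ge_0|].
  apply pow_incr; split; [apply Cmod_ge_0|apply Hz]. }
apply Rle_trans with (1 := H2).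
rewrite <- l2_norm_sq by easy.
assert (Hs := Series_inv_sq_le).
set (S2 := Series _) in *.
apply Rle_trans with (2 * K ^ 2 * l2_norm y ^ 2 + 2 * (K * N) ^ 2 * 2).
{ apply Rplus_le_compat_l, Rmult_le_compat_l; [|easy].
  assert (0 <= (K * N) ^ 2) by apply pow2_ge_0; lra. }
assert (0 <= K ^ 2 * (l2_norm y * N)).
{ apply Rmult_le_pos; [apply pow2_ge_0|now apply Rmult_le_pos]. }
assert (0 <= K ^ 2 * l2_norm y ^ 2) by (apply Rmult_le_pos; apply pow2_ge_0).
assert (0 <= K ^ 2 * N ^ 2) by (apply Rmult_le_pos; apply pow2_ge_0).
replace ((2 * K * (l2_norm y + 2 * N)) ^ 2)
 with (4 * (K ^ 2 * l2_norm y ^ 2) + 16 * (K ^ 2 * (l2_norm y * N)) + 16 * (K ^ 2 * N ^ 2)) by ring.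
replace (2 * K ^ 2 * l2_norm y ^ 2 + 2 * (K * N) ^ 2 * 2)
 with (2 * (K ^ 2 * l2_norm y ^ 2) + 4 * (K ^ 2 * N ^ 2)) by ring.
lra.
Qed.

Lemma in_l2_residual (c : C) (z w : nat -> C) :
  in_l2 z -> in_l2 w -> in_l2 (fun n => c * z n - w n)%C.
Proof.
intros Hz Hw.
apply in_l2_dominated with (fun n => Cmod c * Cmod (z n) + 1 * Cmod (w n)).
- intros n; unfold Cminus; apply Rle_trans with (1 := Cmod_triangle _ _).
  rewrite Cmod_opp, Cmod_mult; lra.
- now apply (ex_series_sq_lincomb (Cmod c) 1).
Qed.

(** Once the equation holds, [opL x] is [lambda x - y], so that it is square
    summable and the vector lies in the domain. *)
Lemma eliminated_solves (P : constants) (M V : R) (lambda q v : C)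
    (delta : R) (y : nat -> C) :
  0 < M -> 0 < V -> lambda <> 0 -> off_modes P M V lambda delta -> in_l2 y ->
  reduced_system P M V lambda q v y ->
  let x := eliminated P M V lambda q v y in
  domL P M V x /\ forall n, (lambda * x n - opL P M V x n)%C = y n.
Proof.
intros HM HV Hl H Hy [E1 E2] x.
destruct (density_rate_eliminated P M V lambda q v delta y HM HV H Hy) as [Hx Hq].
fold x in Hx, Hq.
assert (Hqx : density_rate P M V x = q).
{ rewrite Hq, <- E1; ring. }
assert (Hs : forall n, (lambda * x n - opL P M V x n)%C = y n).
{ intros [|[|[|i]]]; unfold opL; fold (inv_inertia P M V); rewrite ?Hqx;
    [unfold x, eliminated..|].
  - field; easy.
  - field; easy.
  - rewrite !RtoC_mult.
    unfold oscillator, force in E2; rewrite !RtoC_mult in E2.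
    transitivity (((lambda * y 2%nat + RtoC (inv_inertia P M V) *
      (RtoC (gas_cst P) * RtoC (T_c P) * y 0%nat + RtoC (coefA P M V) * y 1%nat))
      - RtoC (inv_inertia P M V) *
      (RtoC (gas_cst P) * RtoC (T_c P) * y 0%nat + RtoC (coefA P M V) * y 1%nat))
      / lambda)%C; [rewrite <- E2|]; field; easy.
  - assert (Hn := off_modes_neq0 P M V lambda delta i H).
    set (t := ((theta y (S i) - RtoC (xi P (S i)) * q)
               / mode_shift P M V lambda (S i))%C).
    change (lambda * t - (- (RtoC (chi P M V * zeta (S i)) * t)
                          - RtoC (xi P (S i)) * q) = theta y (S i))%C.
    unfold t, mode_shift in *; field; easy. }
destruct (eliminated_bound P M V lambda delta Hl H) as (K & HK & Hb).
assert (Hx2 : in_l2 x).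
{ apply (in_l2_bound K (Cmod q + Cmod v) x y); try easy.
  - generalize (Cmod_ge_0 q) (Cmod_ge_0 v); lra.
  - intros n; apply Hb. }
split; [|easy].
split; [easy|split; [easy|]].
replace (opL P M V x) with (fun n => (lambda * x n - y n)%C).
- now apply in_l2_residual.
- apply functional_extensionality; intros n; rewrite <- (Hs n); ring.
Qed.

(** Every solution comes from the reduction, so that uniqueness and the bound on
    the inverse follow from those of the 2 x 2 system. *)
Lemma solution_eliminated (P : constants) (M V : R) (lambda : C) (delta : R)
    (x y : nat -> C) :
  0 < M -> 0 < V -> lambda <> 0 -> off_modes P M V lambda delta -> in_l2 y ->
  (forall n, (lambda * x n - opL P M V x n)%C = y n) ->
  let q := density_rate P M V x in
  let v := x 2%nat in
  x = eliminated P M V lambda q v y /\ reduced_system P M V lambda q v y.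
Proof.
intros HM HV Hl H Hy Hs q v.
assert (Ex : x = eliminated P M V lambda q v y).
{ apply functional_extensionality; intros [|[|[|i]]];
    unfold eliminated.
  - rewrite <- Hs; unfold opL; fold q; field; easy.
  - rewrite <- Hs; unfold opL; fold v; field; easy.
  - reflexivity.
  - assert (Hn := off_modes_neq0 P M V lambda delta i H).
    change (theta y (S i)) with (y (S (S (S i)))); rewrite <- Hs; unfold opL; fold q.
    change (theta x (S i)) with (x (S (S (S i)))).
    unfold mode_shift in *; field; easy. }
split; [easy|split].
- destruct (density_rate_eliminated P M V lambda q v delta y HM HV H Hy) as [_ Hq].
  rewrite <- Ex in Hq; fold q in Hq.
  replace q with (1 * q)%C in Hq at 1 by ring.
  apply (f_equal (fun z => z + (heat_factor P M V lambda - 1) * q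
                           + RtoC (gain P M V) * v)%C) in Hq.
  transitivity (1 * q + (heat_factor P M V lambda - 1) * q
                           + RtoC (gain P M V) * v)%C; [ring|].
  rewrite Hq; ring.
- unfold oscillator, force.
  assert (E0 := Hs 0%nat); assert (E1 := Hs 1%nat); assert (E2 := Hs 2%nat).
  unfold opL in E0, E1, E2; fold (inv_inertia P M V) in E2; fold q in E0.
  fold v in E1, E2.
  rewrite <- E0, <- E1, <- E2, !RtoC_mult; ring.
Qed.

(** * The spectrum and the characteristic equation *)

Lemma reduced_system_Cramer (P : constants) (M V : R) (lambda q v : C)
    (y : nat -> C) :
  char_fun P M V lambda <> 0 ->
  let Y := (RtoC (gain P M V) * heat_source P M V lambda y)%C in
  let W := force P M V lambda y in
  let b := RtoC (inv_inertia P M V * (gas_cst P * T_c P)) in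
  reduced_system P M V lambda q v y <->
  q = ((oscillator P M V lambda * Y - RtoC (gain P M V) * W)
       / char_fun P M V lambda)%C /\
  v = ((heat_factor P M V lambda * W + b * Y) / char_fun P M V lambda)%C.
Proof.
intros HD Y W b.
assert (E : char_fun P M V lambda
  = (heat_factor P M V lambda * oscillator P M V lambda
     + RtoC (gain P M V) * b)%C)
  by (unfold char_fun, b; now rewrite <- RtoC_mult).
unfold reduced_system; fold Y W b; rewrite E in *.
split.
- intros [<- <-]; split; field; easy.
- intros [-> ->]; split; field; easy.
Qed.

Lemma force_bound (P : constants) (M V : R) (lambda : C) :
  exists K, 0 <= K /\ forall y, in_l2 y -> Cmod (force P M V lambda y) <= K * l2_norm y.
Proof.
set (a := RtoC (inv_inertia P M V)); set (g := RtoC (gas_cst P * T_c P)).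
set (c := RtoC (coefA P M V)).
assert (Ha := Cmod_ge_0 a); assert (Hg := Cmod_ge_0 g); assert (Hc := Cmod_ge_0 c).
assert (Hl := Cmod_ge_0 lambda).
exists (Cmod lambda + Cmod a * (Cmod g + Cmod c)); split.
{ assert (0 <= Cmod a * (Cmod g + Cmod c)) by (apply Rmult_le_pos; lra); lra. }
intros y Hy; unfold force; fold a g c.
apply Rle_trans with (1 := Cmod_triangle _ _); rewrite Rmult_plus_distr_r, !Cmod_mult.
apply Rplus_le_compat; [apply Rmult_le_compat_l; [easy|now apply Cmod_le_l2_norm]|].
rewrite Rmult_assoc; apply Rmult_le_compat_l; [easy|].
apply Rle_trans with (1 := Cmod_triangle _ _); rewrite Rmult_plus_distr_r, !Cmod_mult.
apply Rplus_le_compat; apply Rmult_le_compat_l; try easy; now apply Cmod_le_l2_norm.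
Qed.

Lemma Cmod_lincomb_le (a b u v : C) (k l N : R) :
  Cmod u <= k * N -> Cmod v <= l * N ->
  Cmod (a * u + b * v)%C <= (Cmod a * k + Cmod b * l) * N.
Proof.
intros Hu Hv; apply Rle_trans with (1 := Cmod_triangle _ _).
rewrite !Cmod_mult, Rmult_plus_distr_r, !Rmult_assoc.
apply Rplus_le_compat; apply Rmult_le_compat_l; try apply Cmod_ge_0; easy.
Qed.

Lemma reduced_system_bound (P : constants) (M V : R) (lambda : C) (delta : R) :
  off_modes P M V lambda delta -> char_fun P M V lambda <> 0 ->
  exists K, 0 <= K /\ forall y q v, in_l2 y -> reduced_system P M V lambda q v y ->
    Cmod q + Cmod v <= K * l2_norm y.
Proof.
intros H HD.
destruct (force_bound P M V lambda) as (k2 & Hk2 & HW).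
set (g := RtoC (gain P M V)).
set (k1 := 4 * (Rabs (omega P M V 1) / delta)).
assert (Hk1 : 0 <= k1).
{ apply Rmult_le_pos; [lra|].
  apply Rcomplements.Rdiv_le_0_compat; [apply Rabs_pos|apply H]. }
assert (Hp := proj1 (Cmod_gt_0 _) HD).
set (b := RtoC (inv_inertia P M V * (gas_cst P * T_c P))).
set (k3 := (Cmod (oscillator P M V lambda * g) * k1 + Cmod (- g) * k2)
           / Cmod (char_fun P M V lambda)).
set (k4 := (Cmod (heat_factor P M V lambda) * k2 + Cmod (b * g) * k1)
           / Cmod (char_fun P M V lambda)).
exists (k3 + k4); split.
{ apply Rplus_le_le_0_compat; (apply Rcomplements.Rdiv_le_0_compat; [|easy]);
    apply Rplus_le_le_0_compat; apply Rmult_le_pos; try easy; apply Cmod_ge_0. }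
intros y q v Hy Hs.
apply reduced_system_Cramer in Hs; [|easy].
destruct Hs as [-> ->]; fold g b.
assert (HY := heat_source_bound P M V lambda delta y H Hy); fold k1 in HY.
specialize (HW y Hy).
rewrite !Cmod_div by easy.
rewrite Rmult_plus_distr_r; unfold k3, k4, Rdiv.
apply Rplus_le_compat.
- rewrite Rmult_assoc, (Rmult_comm (/ _)), <- Rmult_assoc.
  apply Rmult_le_compat_r; [left; now apply Rinv_0_lt_compat|].
  replace (oscillator P M V lambda * (g * heat_source P M V lambda y)
           - g * force P M V lambda y)%C
    with (oscillator P M V lambda * g * heat_source P M V lambda y
          + - g * force P M V lambda y)%C by ring.
  now apply Cmod_lincomb_le.
- rewrite Rmult_assoc, (Rmult_comm (/ _)), <- Rmult_assoc.
  apply Rmult_le_compat_r; [left; now apply Rinv_0_lt_compat|].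
  rewrite Cmult_assoc; now apply Cmod_lincomb_le.
Qed.

Lemma resolvent_of_char_fun (P : constants) (M V : R) (lambda : C) (delta : R) :
  0 < M -> 0 < V -> lambda <> 0 -> off_modes P M V lambda delta ->
  char_fun P M V lambda <> 0 ->
  in_resolvent_set (domL P M V) (opL P M V) lambda.
Proof.
intros HM HV Hl H HD; split.
- intros y Hy.
  destruct (proj2 (reduced_system_Cramer P M V lambda _ _ y HD) (conj eq_refl eq_refl))
    as [E1 E2].
  assert (Hx := eliminated_solves P M V lambda _ _ delta y HM HV Hl H Hy (conj E1 E2)).
  eexists; split; [exact Hx|].
  intros x [_ Hs].
  destruct (solution_eliminated P M V lambda delta x y HM HV Hl H Hy Hs) as [Ex Hr].
  apply reduced_system_Cramer in Hr; [|easy].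
  destruct Hr as [Eq Ev]; rewrite Eq, Ev in Ex; now symmetry.
- destruct (eliminated_bound P M V lambda delta Hl H) as (K & HK & Hb).
  destruct (reduced_system_bound P M V lambda delta H HD) as (L & HL & Hqv).
  exists (2 * K * (1 + 2 * L)); intros x Hx.
  set (y := fun n => (lambda * x n - opL P M V x n)%C).
  assert (Hy : in_l2 y) by (apply in_l2_residual; apply Hx).
  destruct (solution_eliminated P M V lambda delta x y HM HV Hl H Hy
              (fun n => eq_refl)) as [Ex Hr].
  assert (Hn := Hqv y _ _ Hy Hr).
  set (q := density_rate P M V x) in *; set (v := x 2%nat) in *.
  destruct (in_l2_bound K (Cmod q + Cmod v) x y HK) as [_ Hx2]; try easy.
  { generalize (Cmod_ge_0 q) (Cmod_ge_0 v); lra. }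
  { intros n; rewrite Ex; apply Hb. }
  apply Rle_trans with (1 := Hx2).
  rewrite (Rmult_assoc (2 * K)); apply Rmult_le_compat_l; [lra|].
  fold y; lra.
Qed.

(** The vector [(- a, F)] spans the kernel of the singular 2 x 2 system and gives
    an eigenvector, so that the resolvent equation with zero data has two
    solutions; they differ in the density coordinate, which is [- a / lambda]
    for the eigenvector. *)
Lemma spectrum_of_char_fun (P : constants) (M V : R) (lambda : C) (delta : R) :
  0 < M -> 0 < V -> lambda <> 0 -> off_modes P M V lambda delta ->
  char_fun P M V lambda = 0 -> spL P M V lambda.
Proof.
intros HM HV Hl H HD [Hex _].
set (y := fun _ : nat => RtoC 0).
assert (Hy : in_l2 y).
{ apply in_l2_dominated with (fun n => 0 * / INR (S n)).
  - intros n; unfold y; rewrite Cmod_0; lra.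
  - apply ex_series_ext with (fun n => 0 * (/ INR (S n)) ^ 2).
    + intros n; simpl; ring.
    + apply ex_series_Rscal, ex_series_inv_sq. }
assert (HY : heat_source P M V lambda y = 0).
{ assert (Hn := heat_source_bound P M V lambda delta y H Hy).
  assert (E : l2_norm y = 0).
  { unfold l2_norm, y; rewrite (Series_ext _ (fun n => 0 * (/ INR (S n)) ^ 2)).
    - rewrite Series_scal_l, Rmult_0_l; apply sqrt_0.
    - intros n; rewrite Cmod_0; simpl; ring. }
  rewrite E, Rmult_0_r in Hn.
  apply Cmod_eq_0; apply Rle_antisym; [easy|apply Cmod_ge_0]. }
assert (HW : force P M V lambda y = 0) by (unfold force, y; ring).
set (b := RtoC (inv_inertia P M V * (gas_cst P * T_c P))).
assert (Hdet : (heat_factor P M V lambda * oscillator P M V lambda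
                + RtoC (gain P M V) * b = 0)%C)
  by (rewrite <- HD; unfold char_fun, b; now rewrite <- RtoC_mult).
assert (Hr : reduced_system P M V lambda (- RtoC (gain P M V))
               (heat_factor P M V lambda) y).
{ split; rewrite ?HY, ?HW; fold b; [ring|].
  rewrite <- Hdet; ring. }
assert (Hr0 : reduced_system P M V lambda 0 0 y)
  by (split; rewrite ?HY, ?HW; ring).
destruct (Hex y Hy) as [x [_ Hu]].
assert (U := Hu _ (eliminated_solves P M V lambda _ _ delta y HM HV Hl H Hy Hr)).
assert (U0 := Hu _ (eliminated_solves P M V lambda _ _ delta y HM HV Hl H Hy Hr0)).
rewrite U in U0; apply (f_equal (fun z => z 0%nat)) in U0.
unfold eliminated, y in U0.
assert (E : RtoC (gain P M V) = 0).
{ replace (RtoC (gain P M V)) with (- lambda * ((- RtoC (gain P M V) + 0) / lambda))%C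
    by (field; easy).
  rewrite U0; field; easy. }
apply RtoC_inj in E; assert (Hg := gain_pos P M V HM HV); lra.
Qed.

(** * Roots of the characteristic equation *)

Lemma first_rate_pos (P : constants) (M V : R) :
  0 < M -> 0 < V -> 0 < PI ^ 2 * chi P M V.
Proof.
intros HM HV; apply Rmult_lt_0_compat; [apply pow_lt, PI_RGT_0|now apply chi_pos].
Qed.

Lemma heat_coupling_pos (P : constants) (M V : R) :
  0 < M -> 0 < V -> 0 < 6 * chi P M V * (gamma P - 1).
Proof.
intros HM HV; generalize (chi_pos P M V HM HV) (gamma_gt1 P); intros.
apply Rmult_lt_0_compat; lra.
Qed.

Lemma stiffness_pos (P : constants) (M V : R) :
  0 < M -> 0 < V -> 0 < gain P M V * (inv_inertia P M V * (gas_cst P * T_c P)).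
Proof.
intros HM HV; apply Rmult_lt_0_compat; [now apply gain_pos|].
apply Rmult_lt_0_compat; [now apply inv_inertia_pos|].
apply Rmult_lt_0_compat; [apply gas_cst_pos|apply T_c_pos].
Qed.

(** The shift of the first mode, the pole [- pi^2 chi], controls all others:
    [t] is the fraction of the distance from [0] to that pole which is kept. *)
Lemma mode_lower (P : constants) (M V x t : R) (i : nat) :
  0 < M -> 0 < V -> t <= 1 -> - (1 - t) * (PI ^ 2 * chi P M V) <= x ->
  t * (PI ^ 2 * chi P M V) * INR (S i) ^ 2 <= x + chi P M V * zeta (S i).
Proof.
intros HM HV Ht Hx; unfold zeta.
assert (Hi := INR_S_ge1 i); assert (Hpc := first_rate_pos P M V HM HV).
set (a := PI ^ 2 * chi P M V) in *.
replace (chi P M V * (INR (S i) * PI) ^ 2) with (a * INR (S i) ^ 2) by (unfold a; ring).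
assert (1 <= INR (S i) ^ 2) by nra.
assert (0 <= (1 - t) * a * (INR (S i) ^ 2 - 1)); [|lra].
apply Rmult_le_pos; [apply Rmult_le_pos|]; lra.
Qed.

Lemma off_modes_half_plane (P : constants) (M V t : R) (lambda : C) :
  0 < M -> 0 < V -> 0 < t <= 1 ->
  - (1 - t) * (PI ^ 2 * chi P M V) <= Re lambda ->
  off_modes P M V lambda (t * (PI ^ 2 * chi P M V)).
Proof.
intros HM HV Ht Hx.
split.
- apply Rmult_lt_0_compat; [easy|now apply first_rate_pos].
- intros i.
  apply Rle_trans with (1 := mode_lower P M V (Re lambda) t i HM HV (proj2 Ht) Hx).
  apply Rle_trans with (1 := Rle_abs _).
  apply Rle_trans with (2 := re_le_Cmod _).
  unfold mode_shift, Re; simpl; lra.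
Qed.

Lemma Cmult_plus_R_eq0 (f o : C) (k : R) :
  (f * o + RtoC k)%C = 0 ->
  Re f * Re o - Im f * Im o + k = 0 /\ Re f * Im o + Im f * Re o = 0.
Proof.
intros E; unfold Re, Im; split.
- apply (f_equal fst) in E; simpl in E; lra.
- apply (f_equal snd) in E; simpl in E; lra.
Qed.

(** With [y = Im lambda], the imaginary part of the heat factor is [- y s] and
    that of the oscillator is [y p], where [s] and [p] are positive. The
    equation [F O + k = 0] with [k > 0] implies [|F|^2 Im O = k Im F], whose
    two sides then have opposite signs. *)
Lemma char_fun_nonreal (P : constants) (M V : R) (lambda : C) (delta : R) :
  0 < M -> 0 < V -> off_modes P M V lambda delta -> Im lambda <> 0 ->
  - (inv_inertia P M V * coefB P M V / 2) < Re lambda ->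
  char_fun P M V lambda <> 0.
Proof.
intros HM HV H Hy Hx E.
assert (Hex := ex_heat_factor P M V lambda delta H).
assert (Hc := heat_coupling_pos P M V HM HV).
set (w := fun i => / (Re (mode_shift P M V lambda (S i)) ^ 2 + Im lambda ^ 2)).
assert (Hp : forall i, 0 < w i).
{ intros i; apply Rinv_0_lt_compat.
  assert (0 < Im lambda ^ 2) by now apply pow2_gt_0.
  generalize (pow2_ge_0 (Re (mode_shift P M V lambda (S i)))); lra. }
assert (Hw : forall i, Im (/ mode_shift P M V lambda (S i))%C = - Im lambda * w i).
{ intros i; unfold w.
  assert (Ed : Im lambda = Im (mode_shift P M V lambda (S i)))
    by (unfold mode_shift, Im; simpl; ring).
  rewrite Ed; reflexivity. }
assert (Hsw : ex_series w).
{ assert (Hwe : forall i,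
    - / Im lambda * Im (/ mode_shift P M V lambda (S i))%C = w i)
    by (intros i; rewrite Hw; field; easy).
  apply (ex_series_ext _ _ Hwe), ex_series_Rscal, Hex. }
assert (Hs : 0 < Series w).
{ apply Rlt_le_trans with (1 := Hp 0%nat).
  apply Series_ge_term; [intros k; left; apply Hp|easy]. }
assert (HF : Im (heat_factor P M V lambda)
             = - Im lambda * (6 * chi P M V * (gamma P - 1) * Series w)).
{ unfold heat_factor, Cseries; rewrite (Series_ext _ _ Hw), Series_scal_l.
  unfold Im; simpl; ring. }
assert (HO : Im (oscillator P M V lambda)
             = Im lambda * (2 * Re lambda + inv_inertia P M V * coefB P M V)).
{ unfold oscillator, Im, Re; simpl; ring. }
set (k := gain P M V * (inv_inertia P M V * (gas_cst P * T_c P))).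
assert (Hk : 0 < k) by now apply stiffness_pos.
destruct (Cmult_plus_R_eq0 _ _ _ E) as [Er Ei]; fold k in Er.
set (f1 := Re (heat_factor P M V lambda)) in *.
set (f2 := Im (heat_factor P M V lambda)) in *.
set (o1 := Re (oscillator P M V lambda)) in *.
set (o2 := Im (oscillator P M V lambda)) in *.
(* multiplying the real part by [f2] and eliminating [f2 * o1] *)
assert (E1 : (f1 ^ 2 + f2 ^ 2) * o2 - k * f2 = 0).
{ replace ((f1 ^ 2 + f2 ^ 2) * o2 - k * f2)
    with (f1 * (f1 * o2 + f2 * o1) - f2 * (f1 * o1 - f2 * o2 + k)) by ring.
  rewrite Er, Ei; ring. }
set (s := 6 * chi P M V * (gamma P - 1) * Series w) in *.
assert (Hs' : 0 < s) by now apply Rmult_lt_0_compat.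
set (p := 2 * Re lambda + inv_inertia P M V * coefB P M V) in *.
assert (Hpp : 0 < p) by (unfold p; lra).
assert (E2 : Im lambda * ((f1 ^ 2 + f2 ^ 2) * p + k * s) = 0).
{ rewrite <- E1, HO, HF; ring. }
apply Rmult_integral in E2; destruct E2 as [|E2]; [easy|].
assert (0 <= (f1 ^ 2 + f2 ^ 2) * p).
{ apply Rmult_le_pos; [|lra].
  generalize (pow2_ge_0 f1) (pow2_ge_0 f2); lra. }
assert (0 < k * s) by now apply Rmult_lt_0_compat.
lra.
Qed.

Definition mode_sum (P : constants) (M V x : R) : R :=
  Series (fun i => / (x + chi P M V * zeta (S i))).

(** The determinant [char_fun] on the real axis. *)
Definition char_real (P : constants) (M V x : R) : R :=
  (1 + 6 * chi P M V * (gamma P - 1) * mode_sum P M V x)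
  * (x ^ 2 + inv_inertia P M V * coefB P M V * x - inv_inertia P M V * coefA P M V)
  + gain P M V * (inv_inertia P M V * (gas_cst P * T_c P)).

Lemma char_fun_real (P : constants) (M V x delta : R) :
  off_modes P M V (RtoC x) delta ->
  char_fun P M V (RtoC x) = RtoC (char_real P M V x).
Proof.
intros H.
assert (E : Cseries (fun i => / mode_shift P M V (RtoC x) (S i))%C
            = RtoC (mode_sum P M V x)).
{ rewrite (Cseries_ext _ (fun i => RtoC (/ (x + chi P M V * zeta (S i))))).
  - unfold Cseries; apply injective_projections; simpl; [reflexivity|].
    rewrite (Series_ext _ (fun n => 0 * 0)) by (intros; unfold Im; simpl; ring).
    rewrite (Series_scal_l 0 (fun _ => 0)); ring.
  - intros i; assert (Hn := off_modes_neq0 P M V (RtoC x) delta i H).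
    unfold mode_shift in *; rewrite <- RtoC_plus in *.
    rewrite RtoC_inv; [easy|]; intros E; apply Hn; now rewrite E. }
unfold char_fun, heat_factor, oscillator, char_real; rewrite E.
generalize (6 * chi P M V * (gamma P - 1)), (mode_sum P M V x),
  (inv_inertia P M V * coefB P M V), (inv_inertia P M V * coefA P M V),
  (gain P M V * (inv_inertia P M V * (gas_cst P * T_c P))).
intros c s u w k; apply injective_projections; simpl; ring.
Qed.

Lemma mode_sum_bound (P : constants) (M V x t : R) :
  0 < M -> 0 < V -> 0 < t <= 1 -> - (1 - t) * (PI ^ 2 * chi P M V) <= x ->
  ex_series (fun i => / (x + chi P M V * zeta (S i))) /\
  0 < mode_sum P M V x <= 2 / (t * (PI ^ 2 * chi P M V)).
Proof.
intros HM HV Ht Hx.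
set (d := t * (PI ^ 2 * chi P M V)).
assert (Hd : 0 < d)
  by (apply Rmult_lt_0_compat; [easy|now apply first_rate_pos]).
assert (Hb : forall i, 0 < / (x + chi P M V * zeta (S i)) <= / d * (/ INR (S i)) ^ 2).
{ intros i; assert (Hi := INR_S_ge1 i).
  assert (Hl := mode_lower P M V x t i HM HV (proj2 Ht) Hx); fold d in Hl.
  assert (0 < d * INR (S i) ^ 2) by (apply Rmult_lt_0_compat; [easy|apply pow_lt; lra]).
  split; [apply Rinv_0_lt_compat; lra|].
  replace (/ d * (/ INR (S i)) ^ 2) with (/ (d * INR (S i) ^ 2)) by (field; lra).
  now apply Rinv_le_contravar. }
assert (He : ex_series (fun i => / d * (/ INR (S i)) ^ 2))
  by apply ex_series_Rscal, ex_series_inv_sq.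
assert (Hb' : forall i, 0 <= / (x + chi P M V * zeta (S i)) <= / d * (/ INR (S i)) ^ 2)
  by (intros i; specialize (Hb i); lra).
assert (Hs := ex_series_dominated _ _ Hb' He).
split; [easy|split].
- apply Rlt_le_trans with (1 := proj1 (Hb 0%nat)).
  apply (Series_ge_term (fun i => / (x + chi P M V * zeta (S i)))); [|easy].
  intros k; apply Hb'.
- apply Rle_trans with (1 := Series_le _ _ Hb' He).
  rewrite Series_scal_l.
  unfold Rdiv; rewrite (Rmult_comm 2).
  apply Rmult_le_compat_l; [left; now apply Rinv_0_lt_compat|apply Series_inv_sq_le].
Qed.

Lemma PI_sq_gt_9 : 9 < PI ^ 2.
Proof. generalize PI2_3_2; intros; nra. Qed.

(** The factor multiplying the quadratic is below [(8/3) gamma] and the quadratic is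
    above [- (9/8) m A]; the product is above [- 3 gamma m A], which the
    constant term compensates by [restoring_dominates]. *)
Lemma char_real_pos (P : constants) (M V x : R) :
  0 < M -> 0 < V ->
  - (PI ^ 2 * chi P M V) / 2 <= x -> - (coefA P M V / (8 * coefB P M V)) < x ->
  0 < char_real P M V x.
Proof.
intros HM HV Hx1 Hx2.
assert (Hc := chi_pos P M V HM HV); assert (Hga := gamma_gt1 P).
assert (HA := coefA_pos P M V HM HV); assert (HB := coefB_pos P M V HM HV).
assert (Hm := inv_inertia_pos P M V HM HV).
assert (HE := restoring_dominates P M V HM HV).
destruct (mode_sum_bound P M V x (/ 2) HM HV ltac:(lra) ltac:(lra)) as [_ [Hs1 Hs2]].
assert (Hpi := PI_sq_gt_9).
unfold char_real.
set (f := 1 + 6 * chi P M V * (gamma P - 1) * mode_sum P M V x).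
assert (Hf : 0 < f < 8 / 3 * gamma P).
{ unfold f; split.
  - assert (0 < 6 * chi P M V * (gamma P - 1) * mode_sum P M V x); [|lra].
    apply Rmult_lt_0_compat; [now apply heat_coupling_pos|easy].
  - assert (chi P M V * mode_sum P M V x <= 4 / 9).
    { apply Rle_trans with (chi P M V * (2 / (/ 2 * (PI ^ 2 * chi P M V)))).
      - apply Rmult_le_compat_l; lra.
      - replace (chi P M V * (2 / (/ 2 * (PI ^ 2 * chi P M V)))) with (4 * / PI ^ 2)
          by (field; generalize PI_RGT_0; lra).
        assert (/ PI ^ 2 <= / 9) by (apply Rinv_le_contravar; lra); lra. }
    assert ((gamma P - 1) * (chi P M V * mode_sum P M V x) <= (gamma P - 1) * (4 / 9))
      by (apply Rmult_le_compat_l; lra).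
    lra. }
assert (HBx : - (coefA P M V / 8) < coefB P M V * x).
{ apply (Rmult_lt_compat_l (coefB P M V)) in Hx2; [|easy].
  replace (coefB P M V * - (coefA P M V / (8 * coefB P M V)))
    with (- (coefA P M V / 8)) in Hx2 by (field; lra).
  easy. }
set (m := inv_inertia P M V) in *; set (A := coefA P M V) in *.
assert (Ho : - (9 / 8 * (m * A)) < x ^ 2 + m * coefB P M V * x - m * A).
{ assert (m * - (A / 8) < m * (coefB P M V * x)) by now apply Rmult_lt_compat_l.
  generalize (pow2_ge_0 x); lra. }
set (o := x ^ 2 + m * coefB P M V * x - m * A) in *.
assert (HmA : 0 < m * A) by now apply Rmult_lt_0_compat.
assert (HmE : m * (3 * gamma P * A) <= m * (gain P M V * (gas_cst P * T_c P)))
  by (apply Rmult_le_compat_l; lra).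
assert (f * - (9 / 8 * (m * A)) < f * o) by now apply Rmult_lt_compat_l.
assert (f * (9 / 8 * (m * A)) <= 8 / 3 * gamma P * (9 / 8 * (m * A)))
  by (apply Rmult_le_compat_r; lra).
lra.
Qed.

(** [Theta0] is the least of three fractions: [1/2], which stays away from the
    first pole, and the thresholds of [char_real_pos] and
    [char_fun_nonreal]. *)
Lemma spectrum_upper (P : constants) (M V : R) :
  0 < M -> 0 < V ->
  exists Theta0, 0 < Theta0 < 1 /\
  forall lambda, spL P M V lambda -> lambda <> 0 ->
    Re lambda <= - Theta0 * (PI ^ 2 * chi P M V).
Proof.
intros HM HV.
assert (HA := coefA_pos P M V HM HV); assert (HB := coefB_pos P M V HM HV).
assert (Hm := inv_inertia_pos P M V HM HV).
assert (Ha := first_rate_pos P M V HM HV).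
set (a := PI ^ 2 * chi P M V) in *.
set (t1 := coefA P M V / (8 * coefB P M V)).
set (t2 := inv_inertia P M V * coefB P M V / 2).
assert (H1 : 0 < t1) by (apply Rdiv_lt_0_compat; lra).
assert (H2 : 0 < t2).
{ assert (0 < inv_inertia P M V * coefB P M V) by (apply Rmult_lt_0_compat; lra).
  unfold t2; lra. }
exists (Rmin (/ 2) (Rmin (t1 / a) (t2 / a))).
assert (Hmin : 0 < Rmin (t1 / a) (t2 / a))
  by (apply Rmin_glb_lt; apply Rdiv_lt_0_compat; lra).
set (T := Rmin (/ 2) _).
assert (HT : T <= / 2) by apply Rmin_l.
assert (HT1 : T * a <= t1).
{ apply Rle_div_r; [easy|].
  apply Rle_trans with (1 := Rmin_r _ _); apply Rmin_l. }
assert (HT2 : T * a <= t2).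
{ apply Rle_div_r; [easy|].
  apply Rle_trans with (1 := Rmin_r _ _); apply Rmin_r. }
assert (HT0 : 0 < T) by (apply Rmin_glb_lt; lra).
split; [lra|]; intros lambda Hsp Hl.
apply Rnot_lt_le; intros Hlt; apply Hsp.
assert (HT3 : T * a <= / 2 * a) by (apply Rmult_le_compat_r; lra).
assert (H := off_modes_half_plane P M V (/ 2) lambda HM HV ltac:(lra)
               ltac:(fold a; lra)).
apply resolvent_of_char_fun with (1 := HM) (3 := Hl) (4 := H); [easy|].
destruct (Req_dec (Im lambda) 0) as [Hi|Hi].
- assert (El : lambda = RtoC (Re lambda)) by (apply injective_projections; easy).
  rewrite El in H |- *.
  rewrite (char_fun_real P M V _ _ H); intros E; apply RtoC_inj in E.
  assert (Hp := char_real_pos P M V (Re lambda) HM HV); fold a t1 in Hp.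
  lra.
- apply (char_fun_nonreal P M V lambda _ HM HV H Hi); fold t2; lra.
Qed.

(** [1 / v - 1 / u = - (v - u) / (u v)], and every [u v] is at least
    [d ^ 2 k ^ 2] with [d] the distance kept from the first pole. *)
Lemma mode_sum_Lipschitz (P : constants) (M V x y t : R) :
  0 < M -> 0 < V -> 0 < t <= 1 ->
  - (1 - t) * (PI ^ 2 * chi P M V) <= x -> - (1 - t) * (PI ^ 2 * chi P M V) <= y ->
  Rabs (mode_sum P M V y - mode_sum P M V x)
  <= 2 / (t * (PI ^ 2 * chi P M V)) ^ 2 * Rabs (y - x).
Proof.
intros HM HV Ht Hx Hy.
destruct (mode_sum_bound P M V x t HM HV Ht Hx) as [Ex _].
destruct (mode_sum_bound P M V y t HM HV Ht Hy) as [Ey _].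
unfold mode_sum; rewrite <- Series_minus by easy.
set (d := t * (PI ^ 2 * chi P M V)) in *.
assert (Hd : 0 < d)
  by (apply Rmult_lt_0_compat; [easy|now apply first_rate_pos]).
assert (Hb : forall i, 0 <= Rabs (/ (y + chi P M V * zeta (S i))
                             - / (x + chi P M V * zeta (S i)))
                       <= / d ^ 2 * Rabs (y - x) * (/ INR (S i)) ^ 2).
{ intros i; split; [apply Rabs_pos|].
  assert (Hi := INR_S_ge1 i).
  assert (Lx := mode_lower P M V x t i HM HV (proj2 Ht) Hx); fold d in Lx.
  assert (Ly := mode_lower P M V y t i HM HV (proj2 Ht) Hy); fold d in Ly.
  set (u := x + chi P M V * zeta (S i)) in *; set (v := y + chi P M V * zeta (S i)) in *.
  assert (Hi2 : 1 <= INR (S i) ^ 2) by nra.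
  assert (H1 : d <= d * INR (S i) ^ 2).
  { rewrite <- (Rmult_1_r d) at 1; apply Rmult_le_compat_l; lra. }
  assert (Hu : 0 < u) by lra; assert (Hv : 0 < v) by lra.
  assert (Eyx : y - x = v - u) by (unfold u, v; ring).
  replace (/ v - / u) with (- ((v - u) * / (v * u))) by (field; lra).
  rewrite <- Eyx.
  rewrite Rabs_Ropp, Rabs_mult, (Rabs_pos_eq (/ _))
    by (left; apply Rinv_0_lt_compat, Rmult_lt_0_compat; easy).
  replace (/ d ^ 2 * Rabs (y - x) * (/ INR (S i)) ^ 2)
    with (Rabs (y - x) * / (d * INR (S i) ^ 2 * d)) by (field; lra).
  apply Rmult_le_compat_l; [apply Rabs_pos|].
  apply Rinv_le_contravar; [apply Rmult_lt_0_compat; lra|].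
  apply Rmult_le_compat; try easy; lra. }
assert (He : ex_series (fun i => / d ^ 2 * Rabs (y - x) * (/ INR (S i)) ^ 2))
  by apply ex_series_Rscal, ex_series_inv_sq.
apply Rle_trans with (1 := Series_Rabs _ (ex_series_dominated _ _ Hb He)).
apply Rle_trans with (1 := Series_le _ _ Hb He).
rewrite Series_scal_l.
replace (2 / d ^ 2 * Rabs (y - x)) with (/ d ^ 2 * Rabs (y - x) * 2) by (field; lra).
apply Rmult_le_compat_l; [|apply Series_inv_sq_le].
apply Rmult_le_pos; [|apply Rabs_pos].
left; apply Rinv_0_lt_compat, pow_lt; easy.
Qed.

Lemma mode_sum_continuous (P : constants) (M V x : R) :
  0 < M -> 0 < V -> - (PI ^ 2 * chi P M V) < x ->
  continuity_pt (mode_sum P M V) x.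
Proof.
intros HM HV Hx.
assert (Ha := first_rate_pos P M V HM HV).
set (a := PI ^ 2 * chi P M V) in *.
set (r := (x + a) / 2); assert (Hr : 0 < r) by (unfold r; lra).
set (t := Rmin 1 (r / a)).
assert (Hra : 0 < r / a) by now apply Rdiv_lt_0_compat.
assert (Ht : 0 < t <= 1) by (split; [apply Rmin_glb_lt; lra|apply Rmin_l]).
assert (Htr : t * a <= r) by (apply Rle_div_r; [easy|apply Rmin_r]).
set (L := 2 / (t * a) ^ 2).
assert (HL : 0 < L).
{ apply Rdiv_lt_0_compat; [lra|]. apply pow_lt, Rmult_lt_0_compat; lra. }
intros eps Heps; exists (Rmin r (eps / L)); split.
- apply Rmin_glb_lt; [easy|now apply Rdiv_lt_0_compat].
- intros y [_ Hy].
  change (Rabs (y - x) < Rmin r (eps / L)) in Hy.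
  change (Rabs (mode_sum P M V y - mode_sum P M V x) < eps).
  assert (Hy1 : Rabs (y - x) < r) by (apply Rlt_le_trans with (1 := Hy), Rmin_l).
  assert (Hy2 : Rabs (y - x) < eps / L) by (apply Rlt_le_trans with (1 := Hy), Rmin_r).
  apply Rabs_def2 in Hy1; destruct Hy1 as [_ Hy1].
  assert (Hl : r = x + a - r) by (unfold r; field).
  apply Rle_lt_trans with (L * Rabs (y - x)).
  + apply (mode_sum_Lipschitz P M V x y t); fold a; try easy; lra.
  + rewrite Rmult_comm; now apply Rlt_div_r.
Qed.

(** The hypothesis makes the quadratic factor at most [- eta < 0] on the whole
    interval from [- pi^2 chi] to [0], so that the pole of the first mode drives
    [char_real] to minus infinity at the left end. *)
Lemma spectrum_lower (P : constants) (M V : R) :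
  0 < M -> 0 < V ->
  (PI ^ 2 * chi P M V) ^ 2 < inv_inertia P M V * coefA P M V ->
  exists x, - (PI ^ 2 * chi P M V) < x < 0 /\ spL P M V (RtoC x).
Proof.
intros HM HV Hsmall.
assert (HB := coefB_pos P M V HM HV); assert (HA := coefA_pos P M V HM HV).
assert (Hm := inv_inertia_pos P M V HM HV).
assert (Ha := first_rate_pos P M V HM HV).
set (a := PI ^ 2 * chi P M V) in *.
set (c := 6 * chi P M V * (gamma P - 1)).
assert (Hcp : 0 < c) by now apply heat_coupling_pos.
set (k := gain P M V * (inv_inertia P M V * (gas_cst P * T_c P))).
assert (Hk : 0 < k) by now apply stiffness_pos.
set (eta := inv_inertia P M V * coefA P M V - a ^ 2).
assert (Heta : 0 < eta) by (unfold eta; lra).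
(* the first mode alone makes the heat factor exceed [k / eta] here *)
set (h := Rmin (a / 2) (c * eta / k)).
assert (Hce : 0 < c * eta / k)
  by (apply Rdiv_lt_0_compat; [apply Rmult_lt_0_compat|]; easy).
assert (Hh : 0 < h) by (apply Rmin_glb_lt; lra).
assert (Hh2 : h <= a / 2) by apply Rmin_l.
assert (Hhk : h * k <= c * eta) by (apply Rle_div_r; [easy|apply Rmin_r]).
set (l := - a + h).
assert (Hl : char_real P M V l < 0).
{ assert (Ht : 0 < h / a <= 1).
  { split; [now apply Rdiv_lt_0_compat|apply Rle_div_l; lra]. }
  assert (Hlt : - (1 - h / a) * a <= l) by (unfold l; right; field; lra).
  destruct (mode_sum_bound P M V l (h / a) HM HV Ht Hlt) as [Hs _].
  assert (Hms : / h <= mode_sum P M V l).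
  { replace (/ h) with (/ (l + chi P M V * zeta 1)).
    - apply (Series_ge_term (fun i => / (l + chi P M V * zeta (S i))) 0); [|easy].
      intros i; left; apply Rinv_0_lt_compat.
      assert (Hi := INR_S_ge1 i).
      apply Rlt_le_trans with (2 := mode_lower P M V l _ i HM HV (proj2 Ht) Hlt).
      fold a; apply Rmult_lt_0_compat; [|apply pow_lt; lra].
      now apply Rmult_lt_0_compat.
    - f_equal; unfold l, a, zeta; simpl INR; ring. }
  assert (Ho : l ^ 2 + inv_inertia P M V * coefB P M V * l
               - inv_inertia P M V * coefA P M V <= - eta).
  { assert (l ^ 2 <= a ^ 2) by (unfold l; nra).
    assert (0 < inv_inertia P M V * coefB P M V * - l).
    { apply Rmult_lt_0_compat; [now apply Rmult_lt_0_compat|unfold l; lra]. }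
    unfold eta; lra. }
  unfold char_real; fold c k.
  assert (Hf : 1 + c * / h <= 1 + c * mode_sum P M V l).
  { apply Rplus_le_compat_l, Rmult_le_compat_l; lra. }
  assert (0 < c * / h) by (apply Rmult_lt_0_compat; [easy|now apply Rinv_0_lt_compat]).
  set (f := 1 + c * mode_sum P M V l) in *.
  assert (f * (l ^ 2 + inv_inertia P M V * coefB P M V * l
               - inv_inertia P M V * coefA P M V) <= f * - eta)
    by (apply Rmult_le_compat_l; lra).
  assert ((1 + c * / h) * eta <= f * eta) by (apply Rmult_le_compat_r; lra).
  assert (k <= c * / h * eta).
  { replace (c * / h * eta) with (c * eta / h) by (unfold Rdiv; ring).
    apply (Rle_div_r k (c * eta) h); lra. }
  lra. }
assert (H0 : 0 < char_real P M V 0).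
{ apply char_real_pos; try easy; fold a; [lra|].
  assert (0 < coefA P M V / (8 * coefB P M V)) by (apply Rdiv_lt_0_compat; lra); lra. }
destruct (IVT_interv (char_real P M V) l 0) as [x [[Hx1 Hx2] Hx]]; try easy.
- intros x Hx; unfold char_real.
  apply continuity_pt_plus; [|apply continuity_pt_const; intros ? ?; reflexivity].
  apply continuity_pt_mult.
  + apply continuity_pt_plus; [apply continuity_pt_const; intros ? ?; reflexivity|].
    apply continuity_pt_scal, mode_sum_continuous; try easy; fold a.
    unfold l in Hx; lra.
  + apply derivable_continuous_pt, ex_derive_Reals_0; auto_derive; easy.
- unfold l; lra.
- assert (Hx0 : x < 0).
  { destruct Hx2 as [|E]; [easy|rewrite E in Hx; lra]. }
  exists x; split; [unfold l in Hx1; lra|].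
  assert (Ht : 0 < h / a <= 1).
  { split; [now apply Rdiv_lt_0_compat|apply Rle_div_l; lra]. }
  assert (H : off_modes P M V (RtoC x) (h / a * a)).
  { apply off_modes_half_plane; try easy; fold a.
    simpl Re. replace (- (1 - h / a) * a) with l by (unfold l; field; lra). easy. }
  apply (spectrum_of_char_fun P M V (RtoC x) (h / a * a) HM HV); try easy.
  + intros E; apply RtoC_inj in E; lra.
  + rewrite (char_fun_real P M V x _ H), Hx; easy.
Qed.

(** * Size of the leading rate, and thin liquid layers *)

(** The constant ratio of [pi^2 chi] to the equilibrium radius. *)
Definition rate_slope (P : constants) (M : R) : R :=
  4 * kappa P * PI ^ 3 / (3 * M * gamma P * heat_cap P).

Lemma rate_slope_pos (P : constants) (M : R) : 0 < M -> 0 < rate_slope P M.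
Proof.
intros HM; generalize (kappa_pos P) (heat_cap_pos P) (gamma_gt1 P); intros.
apply Rdiv_lt_0_compat.
- apply Rmult_lt_0_compat; [lra|apply pow_lt, PI_RGT_0].
- apply Rmult_lt_0_compat; [|easy]; apply Rmult_lt_0_compat; lra.
Qed.

Lemma first_rateE (P : constants) (M V : R) :
  0 < M -> 0 < V -> PI ^ 2 * chi P M V = rate_slope P M * R_dag P M V.
Proof.
intros HM HV.
destruct (equilibrium_eqs P M V HM HV) as (Hr & Hp & E & _).
unfold chi, rate_slope; rewrite E.
generalize (heat_cap_pos P) (gamma_gt1 P) PI_RGT_0; intros.
field; repeat split; lra.
Qed.

Lemma R_dag_sq_bounds (P : constants) (M V : R) :
  0 < M -> 0 < V ->
  let K := 3 * M * (gas_cst P * T_c P) / (8 * PI) in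
  K / (sigma_in P + sigma_out P) < R_dag P M V ^ 2 < K / sigma_in P.
Proof.
intros HM HV K.
destruct (equilibrium_eqs P M V HM HV) as (Hr & _ & _ & _ & E); fold K in E.
assert (Hlt := R_dag_lt_R_bar_dag P M V HM HV).
unfold balance in E; fold (R_bar_dag P M V) in E.
assert (Hs := sigma_in_pos P); assert (Ho := sigma_out_pos P).
set (r := R_dag P M V) in *; set (s := R_bar_dag P M V) in *.
assert (H0 : 0 < r / s) by (apply Rdiv_lt_0_compat; lra).
assert (H1 : r / s < 1) by (apply Rlt_div_l; lra).
assert (Hr2 : 0 < r ^ 2) by now apply pow_lt.
rewrite <- E; split.
- apply Rlt_div_l; [lra|]; apply Rmult_lt_compat_l; [easy|].
  assert (sigma_out P * (r / s) < sigma_out P * 1) by now apply Rmult_lt_compat_l.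
  lra.
- apply (Rlt_div_r (r ^ 2)); [lra|]; apply Rmult_lt_compat_l; [easy|].
  assert (0 < sigma_out P * (r / s)) by now apply Rmult_lt_0_compat.
  lra.
Qed.

Lemma pow2_lt_cancel (x y : R) : 0 <= y -> x ^ 2 < y ^ 2 -> x < y.
Proof. intros; nra. Qed.

Lemma first_rate_bounds (P : constants) (M V : R) :
  0 < M -> 0 < V ->
  let X := kappa P * PI ^ 2 / (gamma P * heat_cap P)
           * sqrt (2 * PI * gas_cst P / (3 * sigma_in P)) * sqrt (T_c P / M) in
  X / sqrt (1 + sigma_out P / sigma_in P) < PI ^ 2 * chi P M V < X.
Proof.
intros HM HV X.
assert (Hk := kappa_pos P); assert (Hh := heat_cap_pos P); assert (Hg := gamma_gt1 P).
assert (Hs := sigma_in_pos P); assert (Ho := sigma_out_pos P).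
assert (HG := gas_cst_pos P); assert (HT := T_c_pos P); assert (Hpi := PI_RGT_0).
assert (H1 : 0 < 2 * PI * gas_cst P / (3 * sigma_in P))
  by (apply Rdiv_lt_0_compat; [apply Rmult_lt_0_compat|]; lra).
assert (H2 : 0 < T_c P / M) by now apply Rdiv_lt_0_compat.
assert (H3 : 0 < 1 + sigma_out P / sigma_in P).
{ assert (0 < sigma_out P / sigma_in P) by now apply Rdiv_lt_0_compat. lra. }
assert (HX : 0 < X).
{ apply Rmult_lt_0_compat; [apply Rmult_lt_0_compat|]; try now apply sqrt_lt_R0.
  apply Rdiv_lt_0_compat; apply Rmult_lt_0_compat; try apply pow_lt; lra. }
assert (Hq : 0 < sqrt (1 + sigma_out P / sigma_in P)) by now apply sqrt_lt_R0.
set (K := 3 * M * (gas_cst P * T_c P) / (8 * PI)).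
assert (EX : X ^ 2 = rate_slope P M ^ 2 * (K / sigma_in P)).
{ unfold X; rewrite !Rpow_mult_distr, !pow2_sqrt by lra.
  unfold rate_slope, K; field; repeat split; lra. }
destruct (R_dag_sq_bounds P M V HM HV) as [L U]; fold K in L, U.
assert (HC := rate_slope_pos P M HM); assert (Hr := R_dag_pos P M V HM HV).
assert (HC2 : 0 < rate_slope P M ^ 2) by now apply pow_lt.
rewrite first_rateE by easy; split.
- apply pow2_lt_cancel; [apply Rmult_le_pos; lra|].
  unfold Rdiv; rewrite !Rpow_mult_distr, EX, pow_inv, pow2_sqrt by lra.
  replace (rate_slope P M ^ 2 * (K / sigma_in P) * / (1 + sigma_out P * / sigma_in P))
    with (rate_slope P M ^ 2 * (K / (sigma_in P + sigma_out P)))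
    by (field; repeat split; lra).
  now apply Rmult_lt_compat_l.
- apply pow2_lt_cancel; [lra|].
  rewrite EX, Rpow_mult_distr; now apply Rmult_lt_compat_l.
Qed.

(** [inv_inertia * A >= 2 sigma / (rho_l R_tilde R^2)] and
    [R_tilde R^2 <= V_bar], whereas [pi^2 chi] stays bounded because the radius
    does. *)
Lemma thin_liquid_layer (P : constants) (M : R) :
  0 < M -> exists V0, 0 < V0 /\ forall V, 0 < V < V0 ->
  (PI ^ 2 * chi P M V) ^ 2 < inv_inertia P M V * coefA P M V.
Proof.
intros HM.
assert (Hs := sigma_in_pos P); assert (Hrl := rho_l_pos P); assert (Hpi := PI_RGT_0).
assert (HC2 : 0 < rate_slope P M ^ 2) by now apply pow_lt, rate_slope_pos.
set (K := 3 * M * (gas_cst P * T_c P) / (8 * PI)).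
assert (HK : 0 < K).
{ apply Rdiv_lt_0_compat; [|lra].
  repeat apply Rmult_lt_0_compat; try lra; [apply gas_cst_pos|apply T_c_pos]. }
set (c := rho_l P * (rate_slope P M ^ 2 * (K / sigma_in P))).
assert (Hc : 0 < c).
{ apply Rmult_lt_0_compat; [easy|]; apply Rmult_lt_0_compat; [easy|].
  now apply Rdiv_lt_0_compat. }
exists (4 * PI / 3 * (2 * sigma_in P / c)); split.
{ apply Rmult_lt_0_compat; [lra|]. apply Rdiv_lt_0_compat; lra. }
intros V [HV HV0].
assert (Hr := R_dag_pos P M V HM HV).
destruct (R_tilde_dag_bounds P M V HM HV) as [Ht Hb].
destruct (R_dag_sq_bounds P M V HM HV) as [_ U]; fold K in U.
assert (HA := coefA_lower P M V HM HV).
assert (Hv : V_bar V * c < 2 * sigma_in P).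
{ apply Rlt_div_r; [easy|]; unfold V_bar.
  apply Rlt_div_l; [lra|].
  apply (Rmult_lt_compat_l 3) in HV0; [|lra].
  apply Rlt_le_trans with (1 := HV0); right; field; lra. }
rewrite first_rateE, Rpow_mult_distr by easy.
unfold inv_inertia.
set (r := R_dag P M V) in *; set (t := R_tilde_dag P M V) in *.
set (S := rate_slope P M ^ 2) in *.
assert (Hr2 : 0 < r ^ 2) by now apply pow_lt.
assert (Hi : 0 < rho_l P * t) by now apply Rmult_lt_0_compat.
rewrite (Rmult_comm (/ _)).
apply (Rlt_div_r (S * r ^ 2) (coefA P M V) (rho_l P * t)); [easy|].
apply Rle_lt_trans with (2 := HA).
apply (Rle_div_r _ (2 * sigma_in P) (r ^ 2)); [easy|].
apply Rle_trans with (2 := Rlt_le _ _ Hv).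
assert (Hl : S * r ^ 2 <= S * (K / sigma_in P)) by (apply Rmult_le_compat_l; lra).
replace (S * r ^ 2 * (rho_l P * t) * r ^ 2)
  with ((t * r ^ 2) * (rho_l P * (S * r ^ 2))) by ring.
assert (0 <= t * r ^ 2) by (apply Rmult_le_pos; lra).
assert (0 <= S * r ^ 2) by (apply Rmult_le_pos; lra).
apply Rmult_le_compat; try easy.
- apply Rmult_le_pos; lra.
- apply Rmult_le_compat_l; lra.
Qed.

Theorem mainTheorem6 (P : constants) (M : R) (HM : 0 < M) :
  exists V0 : R, 0 < V0 /\
  forall V : R, 0 < V < V0 ->
  (exists Theta0 : R, 0 < Theta0 < 1 /\
     Rbar_lt (Finite (- (PI ^ 2 * chi P M V))) (spectral_sup P M V) /\
     Rbar_le (spectral_sup P M V) (Finite (- Theta0 * (PI ^ 2 * chi P M V)))) /\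
  - (PI ^ 2 * chi P M V)
    = - (4 * kappa P * PI ^ 3 * R_dag P M V
         / (3 * M * gamma P * heat_cap P)) /\
  kappa P * PI ^ 2 / (gamma P * heat_cap P)
    * sqrt (2 * PI * gas_cst P / (3 * sigma_in P))
    * - sqrt (T_c P / M)
  < - (PI ^ 2 * chi P M V)
  < kappa P * PI ^ 2 / (gamma P * heat_cap P)
    * sqrt (2 * PI * gas_cst P / (3 * sigma_in P))
    * - (sqrt (T_c P / M) / sqrt (1 + sigma_out P / sigma_in P)).
Proof.
destruct (thin_liquid_layer P M HM) as (V0 & HV0 & Hthin).
exists V0; split; [easy|]; intros V HVV.
assert (HV : 0 < V) by apply HVV.
split; [|split].
- destruct (spectrum_upper P M V HM HV) as (T & HT & Hup).
  destruct (spectrum_lower P M V HM HV (Hthin V HVV)) as (x & Hx & Hsx).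
  exists T; split; [easy|].
  assert (Hlub := Lub_Rbar_correct (fun r => exists lambda : C,
    spL P M V lambda /\ lambda <> RtoC 0 /\ r = Re lambda)).
  fold (spectral_sup P M V) in Hlub; destruct Hlub as [Hub Hleast]; split.
  + apply Rbar_lt_le_trans with (Finite x); [apply Hx|].
    apply Hub; exists (RtoC x); split; [easy|split; [|easy]].
    intros E; apply RtoC_inj in E; lra.
  + apply Hleast; intros r (lambda & Hsp & Hl & ->).
    now apply Hup.
- rewrite first_rateE by easy; unfold rate_slope.
  generalize (heat_cap_pos P) (gamma_gt1 P); intros.
  field; repeat split; lra.
- destruct (first_rate_bounds P M V HM HV) as [L U].
  unfold Rdiv in *; split; lra.
Qed.
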